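(* Let $X, X_1, X_2, \ldots$ be i.i.d. $\mathbb{R}^d$-valued random variables ($d\ge 1$) whose common distribution has a Lebesgue density $f$. Assume that the kernel $K$ satisfies conditions (K.i), (K.ii), (K.iii), (K.iv), (K.v) listed in the context. Then for any sequences $0<a_n<b_n<1$ satisfying $b_n\to0$ and $na_n/\log n\to\infty$, and any uniformly continuous density $f$, $$\lim_{n\to\infty}\ \sup_{a_n\le h\le b_n}\|\widehat f_{n,h}-f\|_\infty=0\qquad\text{almost surely.}$$
   Context: A kernel is a measurable function $K:\mathbb{R}^d\to\mathbb{R}$. For bandwidth $h>0$ the kernel density estimator is $$\widehat{f}_{n,h}(x) = (nh)^{-1}\sum_{i=1}^n K\big((x-X_i)/h^{1/d}\big),\qquad x\in\mathbb{R}^d,$$ and $\|\psi\|_\infty=\sup_{x\in\mathbb{R}^d}|\psi(x)|$. Conditions on $K$: (K.i) $\int_{\mathbb{R}^d}K(s)\,ds=1$. (K.ii) $\|K\|_\infty=\sup_{x\in\mathbb{R}^d}|K(x)|=\kappa<\infty$. Let $\mathcal{K}=\{K((x-\cdot)/h^{1/d}): h>0,\ x\in\mathbb{R}^d\}$. For $\varepsilon>0$ let $N(\varepsilon,\mathcal{K})=\sup_Q N(\kappa\varepsilon,\mathcal{K},d_Q)$, the supremum being over all probability measures $Q$ on the Borel sets of $\mathbb{R}^d$, where $d_Q$ is the $L_2(Q)$-metric and $N(\delta,\mathcal{K},d_Q)$ is the minimal number of balls $\{g: d_Q(g,g')<\delta\}$ of $d_Q$-radius $\delta$ needed to cover $\mathcal{K}$.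 (K.iii) For some $C>0$ and $\nu>0$, $N(\varepsilon,\mathcal{K})\le C\varepsilon^{-\nu}$ for all $0<\varepsilon<1$. (K.iv) $\mathcal{K}$ is a pointwise measurable class: there is a countable subclass $\mathcal{K}_0\subset\mathcal{K}$ such that for every $g\in\mathcal{K}$ there is a sequence $\{g_m\}$ in $\mathcal{K}_0$ with $g_m(z)\to g(z)$ for all $z\in\mathbb{R}^d$. (K.v) $\int_{\mathbb{R}^d}\Psi_K(x)\,dx<\infty$, where $\Psi_K(x)=\sup_{|y|\ge|x|}|K(y)|$, $x\in\mathbb{R}^d$. *)

(* Defs.v *)
From HB Require Import structures.
From mathcomp Require Import all_boot all_order all_algebra finmap.
From mathcomp Require Import all_classical all_reals all_analysis.

Set Implicit Arguments.
Unset Strict Implicit.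
Unset Printing Implicit Defensive.

Import Order.TTheory GRing.Theory Num.Theory.
Import numFieldNormedType.Exports.

Local Open Scope classical_set_scope.
Local Open Scope ring_scope.

(* R^d is 'rV[R]_d. Matrices over a realType carry the product topology; the  *)
(* instance below equips them with the corresponding Borel sigma-algebra.     *)

Definition mx_borel_display : measure_display. Proof. exact. Qed.

Section matrix_borel.
Context {R : realType} (m n : nat).

Let mx_borel0 : <<s @open 'M[R]_(m, n) >> set0.
Proof. exact: sigma_algebra0. Qed.

Let mx_borelC A : <<s @open 'M[R]_(m, n) >> A ->
  <<s @open 'M[R]_(m, n) >> (~` A).
Proof. exact: sigma_algebraC. Qed.

Let mx_borel_bigcup (F : (set 'M[R]_(m, n))^nat) :
  (forall i, <<s @open 'M[R]_(m, n) >> (F i)) ->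
  <<s @open 'M[R]_(m, n) >> (\bigcup_i F i).
Proof. exact: sigma_algebra_bigcup. Qed.

HB.instance Definition _ := @isMeasurable.Build mx_borel_display
  'M[R]_(m, n) <<s @open 'M[R]_(m, n) >> mx_borel0 mx_borelC mx_borel_bigcup.

Lemma measurable_mxE :
  @measurable _ 'M[R]_(m, n) = <<s @open 'M[R]_(m, n) >>.
Proof. by []. Qed.

Lemma measurable_mx_coord (i : 'I_m) (j : 'I_n) :
  measurable_fun [set: 'M[R]_(m, n)] (fun M : 'M[R]_(m, n) => M i j).
Proof.
apply: (measurability _ (measurable_realfun.RGenOpens.measurableE R)) => _ [_ [a [b ->]] <-].
rewrite setTI; apply: sub_sigma_algebra.
have /continuousP := @coord_continuous R m n i j; apply.
exact: interval_open.
Qed.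

Lemma measurable_fun_mxP d (T : measurableType d) (f : T -> 'M[R]_(m, n)) :
  (forall i j, measurable_fun [set: T] (fun x => f x i j)) ->
  measurable_fun [set: T] f.
Proof.
move=> mf; apply: (measurability _ measurable_mxE) => _ [U oU <-].
rewrite setTI.
pose B (q : 'M[rat]_(m, n) * nat) : set 'M[R]_(m, n) :=
  ball (map_mx ratr q.1 : 'M[R]_(m, n)) q.2.+1%:R^-1.
pose F q : set T := if `[< B q `<=` U >] then f @^-1` B q else set0.
rewrite [X in measurable X](_ : _ = \bigcup_q F q).
  apply: countable_bigcupT_measurable => // q.
  rewrite /F; case: ifPn => // _.
  rewrite [X in measurable X](_ : _ = \bigcap_(ij in [set: 'I_m * 'I_n])
     ((fun x => f x ij.1 ij.2) @^-1` ball (ratr (q.1 ij.1 ij.2) : R) q.2.+1%:R^-1)).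
    apply: fin_bigcap_measurable => [|[i j] _ /=]; first exact: finite_finset.
    rewrite -[X in measurable X]setTI; apply: mf => //.
    exact: measurable_realfun.measurable_ball.
  apply/seteqP; split => x /=.
    by move=> [_ H] [i j] _ /=; have := H i j; rewrite mxE.
  move=> H; split; first by rewrite invr_gt0.
  by move=> i j; have := H (i, j) I; rewrite mxE.
apply/seteqP; split => x /=; last first.
  by move=> [q _]; rewrite /F; case: ifPn => // /asboolP; apply.
move=> Ufx.
have /nbhs_ballP[e /= e0 eU] : nbhs (f x) U by exact: open_nbhs_nbhs.
have e20 : 0 < e / 2 by rewrite divr_gt0.
pose k := Num.bound (e / 2)^-1.
have ke : k.+1%:R^-1 < e / 2.
  rewrite -[ltRHS]invrK ltf_pV2 ?posrE ?invr_gt0//.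
  have /archi_boundP/lt_le_trans : 0 <= (e / 2)^-1 by rewrite invr_ge0 ltW.
  by apply; rewrite ler_nat.
have H (ij : 'I_m * 'I_n) : exists q : rat,
    ball (f x ij.1 ij.2) k.+1%:R^-1 (ratr q : R).
  have k0 : 0 < k.+1%:R^-1 :> R by rewrite invr_gt0.
  have [_ [/[swap] -[q _ <-] ?]] := @dense_rat R _
    (ex_intro _ (f x ij.1 ij.2) (ballxx _ k0)) (ball_open (f x ij.1 ij.2 : R^o) _).
  by exists q.
have [g gP] := choice H.
exists (\matrix_(i, j) g (i, j), k) => //.
have Bx : ball (map_mx ratr (\matrix_(i, j) g (i, j)) : 'M[R]_(m, n))
    k.+1%:R^-1 (f x).
  split; first by rewrite invr_gt0.
  by move=> i j; rewrite !mxE; apply: ball_sym; exact: (gP (i, j)).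
rewrite /F ifT//; apply/asboolP => y By; apply: eU.
rewrite [e]splitr; apply: (ball_triangle (y := map_mx ratr (\matrix_(i, j) g (i, j)) : 'M[R]_(m, n))).
  by apply: ball_sym; apply: le_ball Bx; exact: ltW.
by apply: le_ball By; exact: ltW.
Qed.

End matrix_borel.

(* Lebesgue measure on R^d, by induction on d: R^0 is a single point of mass  *)
(* 1, and R^(n+1) is identified with R x R^n.                                 *)

Section lebesgue_rV.
Context {R : realType}.

Definition rV_cons n (p : R * 'rV[R]_n) : 'rV[R]_n.+1 := row_mx p.1%:M p.2.

Lemma rV_cons0 n (p : R * 'rV[R]_n) : rV_cons p ord0 ord0 = p.1.
Proof.
have -> : ord0 = lshift n (ord0 : 'I_1) :> 'I_n.+1 by exact: val_inj.
by rewrite /rV_cons (row_mxEl (p.1%:M : 'M[R]_1)) mxE eqxx mulr1n.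
Qed.

Lemma rV_consS n (p : R * 'rV[R]_n) j :
  rV_cons p ord0 (lift ord0 j) = p.2 ord0 j.
Proof.
have -> : lift ord0 j = rshift 1 j :> 'I_n.+1 by exact: val_inj.
by rewrite /rV_cons (row_mxEr (p.1%:M : 'M[R]_1)).
Qed.

Lemma measurable_rV_cons n :
  measurable_fun [set: measurableTypeR R * 'rV[R]_n] (@rV_cons n).
Proof.
apply: measurable_fun_mxP => i j; rewrite (ord1 i).
have [->|[k ->]] : j = ord0 \/ exists k, j = lift ord0 k.
- by case: (unliftP ord0 j) => [k ->|->]; [right; exists k|left].
- under eq_fun do rewrite rV_cons0.
  exact: measurable_fst.
- under eq_fun do rewrite rV_consS.
  exact: measurableT_comp (measurable_mx_coord _ _) measurable_snd.
Qed.

Section step.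
Variables (n : nat) (mu : {sigma_finite_measure set 'rV[R]_n -> \bar R}).

Definition lebesgue_rV_step : set 'rV[R]_n.+1 -> \bar R :=
  pushforward (@lebesgue_measure R \x mu)%E (@rV_cons n).

Let mcons := @measurable_rV_cons n.

Let step0 : lebesgue_rV_step set0 = 0%E.
Proof. exact: measure0. Qed.

Let step_ge0 A : (0 <= lebesgue_rV_step A)%E.
Proof. exact: measure_ge0. Qed.

Let step_sigma_additive : semi_sigma_additive lebesgue_rV_step.
Proof.
move=> F mF tF mUF; rewrite /lebesgue_rV_step /pushforward preimage_bigcup.
apply: measure_semi_sigma_additive.
- by move=> k; rewrite -[X in measurable X]setTI; exact: mcons.
- apply/trivIsetP => /= i j _ _ ij; rewrite -preimage_setI.
  by move/trivIsetP : tF => /(_ _ _ _ _ ij) ->//; rewrite preimage_set0.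
- by rewrite -preimage_bigcup -[X in measurable X]setTI; exact: mcons.
Qed.

HB.instance Definition _ := isMeasure.Build _ _ _ lebesgue_rV_step
  step0 step_ge0 step_sigma_additive.

Lemma lebesgue_rV_step_setX (A : set R) (B : set 'rV[R]_n) :
  measurable A -> measurable B ->
  lebesgue_rV_step [set v | A (v ord0 ord0) /\
    B (\row_j v ord0 (lift ord0 j))] = (lebesgue_measure A * mu B)%E.
Proof.
move=> mA mB; rewrite -product_measure1E//.
rewrite /lebesgue_rV_step /pushforward; congr (_ _).
apply/seteqP; split => -[x v] /=.
  rewrite rV_cons0 => -[Ax]; rewrite (_ : \row_j _ = v)//.
  by apply/rowP => j; rewrite mxE rV_consS.
move=> [Ax Bv]; rewrite rV_cons0; split => //.
by rewrite (_ : \row_j _ = v)//; apply/rowP => j; rewrite mxE rV_consS.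
Qed.

Let step_sigma_finite : sigma_finite setT lebesgue_rV_step.
Proof.
have /sigma_finiteP[F [TF ndF Foo]] := sigma_finiteT (@lebesgue_measure R).
have /sigma_finiteP[G [TG ndG Goo]] := sigma_finiteT mu.
exists (fun k => [set v : 'rV[R]_n.+1 | F k (v ord0 ord0) /\
    G k (\row_j v ord0 (lift ord0 j))]).
  apply/esym; rewrite -subTset => v _.
  have [i _ Fi] : (\bigcup_i F i) (v ord0 ord0) by rewrite -TF.
  have [j _ Gj] : (\bigcup_i G i) (\row_j v ord0 (lift ord0 j)) by rewrite -TG.
  exists (maxn i j) => //; split.
  - by move: Fi; exact/subsetPset/ndF/leq_maxl.
  - by move: Gj; exact/subsetPset/ndG/leq_maxr.
move=> k; have [mF Fk] := Foo k; have [mG Gk] := Goo k; split.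
  apply: measurableI; rewrite -[X in measurable X]setTI.
    exact: (measurable_mx_coord ord0 ord0).
  apply: (measurable_fun_mxP (f := fun v : 'rV[R]_n.+1 =>
    \row_j v ord0 (lift ord0 j))) => // i j.
  under eq_fun do rewrite mxE.
  exact: measurable_mx_coord.
by rewrite lebesgue_rV_step_setX// lte_mul_pinfty// ge0_fin_numE.
Qed.

HB.instance Definition _ := Measure_isSigmaFinite.Build _ _ _
  lebesgue_rV_step step_sigma_finite.

End step.

Fixpoint lebesgue_rV n : {sigma_finite_measure set 'rV[R]_n -> \bar R} :=
  match n with
  | 0 => \d_(0 : 'rV[R]_0)
  | n.+1 => lebesgue_rV_step (lebesgue_rV n)
  end.

(* Volume of a box, the characteristic property of Lebesgue measure. *)
Lemma lebesgue_rV_box n (A : 'I_n -> set R) : (forall i, measurable (A i)) ->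
  lebesgue_rV n [set v | forall i, A i (v ord0 i)] =
  (\prod_(i < n) lebesgue_measure (A i))%E.
Proof.
elim: n => [|n IHn] in A *; move=> mA.
  rewrite big_ord0 /= diracE mem_set//.
  by case.
rewrite big_ord_recl -IHn// -lebesgue_rV_step_setX//; last first.
  rewrite [X in measurable X](_ : _ = \bigcap_(i in [set: 'I_n])
    ((fun v : 'rV[R]_n => v ord0 i) @^-1` A (lift ord0 i))); last first.
    by apply/seteqP; split => v /= Av i; [move=> _; exact: Av|exact: (Av i I)].
  apply: fin_bigcap_measurable => [|i _]; first exact: finite_finset.
  by rewrite -[X in measurable X]setTI; exact: measurable_mx_coord.
congr (_ _); apply/seteqP; split => v /=.
  by move=> Av; split=> [|i]; rewrite ?mxE; exact: Av.
move=> [A0 Av] i; case: (unliftP ord0 i) => [j ->|->//].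
by have := Av j; rewrite mxE.
Qed.

End lebesgue_rV.

Section sup_norm.
Context {T : Type} {R : realType}.

Definition sup_norm (psi : T -> R) : \bar R :=
  ereal_sup [set `|psi x|%:E | x in [set: T]].

End sup_norm.

(* The canonical norm of 'rV[R]_d is the max-norm, hence this definition. *)
Definition enorm {R : realType} d (x : 'rV[R]_d) : R :=
  Num.sqrt (\sum_(i < d) x ord0 i ^+ 2).

Section covering_numbers.
Context disp {T : measurableType disp} {R : realType}.

Definition L2_dist (Q : probability T R) (g g' : T -> R) : \bar R :=
  'N[Q]_2%:E [EFin \o (fun z => (g z - g' z)%R)]%E.

(* The centres of the balls are arbitrary elements of L_2(Q). The value is    *)
(* +oo when no finite family of balls covers F.                               *)
Definition covering_number (Q : probability T R) (F : set (T -> R))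
    (delta : R) : \bar R :=
  ereal_inf [set N%:R%:E | N in [set N : nat | exists c : 'I_N -> T -> R,
    (forall i, c i \in Lfun Q 2%:E) /\
    F `<=` \bigcup_(i in [set: 'I_N])
             [set g | (L2_dist Q g (c i) < delta%:E)%E] ]].

Definition uniform_covering_number (F : set (T -> R)) (delta : R) : \bar R :=
  ereal_sup [set covering_number Q F delta | Q in [set: probability T R]].

End covering_numbers.

Definition pointwise_measurable_class {T : Type} {R : realType}
    (F : set (T -> R)) : Prop :=
  exists F0 : set (T -> R), [/\ F0 `<=` F, countable F0 &
    forall g, F g -> exists u : nat -> T -> R,
      (forall m, F0 (u m)) /\ (forall z, u m z @[m --> \oo] --> g z)].

Section kernel.
Context {R : realType} {d : nat}.
Implicit Type K : 'rV[R]_d -> R.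

Definition rescale (h : R) (v : 'rV[R]_d) : 'rV[R]_d :=
  (h `^ (d%:R^-1))^-1 *: v.

Definition kernel_class K : set ('rV[R]_d -> R) :=
  [set g | exists h x, 0 < h /\ g = fun z => K (rescale h (x - z))].

Definition radial_majorant K (x : 'rV[R]_d) : \bar R :=
  ereal_sup [set `|K y|%:E | y in [set y | enorm x <= enorm y]].

(* The sample of size n is xs 0, ..., xs (n - 1). *)
Definition kde K (xs : nat -> 'rV[R]_d) (n : nat) (h : R) (x : 'rV[R]_d) : R :=
  (n%:R * h)^-1 * \sum_(i < n) K (rescale h (x - xs i)).

End kernel.

Section random_vectors.
Context disp disp' {Omega : measurableType disp} {T : measurableType disp'}
  {R : realType} (P : probability Omega R).

Definition mutually_independent (X : nat -> {RV P >-> T}) : Prop :=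
  forall (J : {fset nat}) (B : nat -> set T),
    (forall i, i \in J -> measurable (B i)) ->
    P (\bigcap_(i in [set` J]) X i @^-1` B i) =
    (\prod_(i <- J) P (X i @^-1` B i))%E.

Definition identically_distributed (X : nat -> {RV P >-> T}) : Prop :=
  forall i (B : set T), measurable B ->
    distribution P (X i) B = distribution P (X 0%N) B.

End random_vectors.

Arguments mutually_independent {disp disp' Omega T R} P X.
Arguments identically_distributed {disp disp' Omega T R} P X.

Definition has_lebesgue_density disp (Omega : measurableType disp) (R : realType)
    (P : probability Omega R) d (Y : {RV P >-> 'rV[R]_d})
    (f : 'rV[R]_d -> R) : Prop :=
  [/\ measurable_fun [set: 'rV[R]_d] f, (forall x, 0 <= f x) &
    forall B : set 'rV[R]_d, measurable B ->
      distribution P Y B = (\int[lebesgue_rV d]_(x in B) (f x)%:E)%E].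

Arguments has_lebesgue_density {disp Omega R} P {d} Y f.

(* Main.v *)
Require Import Defs.
From HB Require Import structures.
From mathcomp Require Import all_boot all_order all_algebra finmap.
From mathcomp Require Import all_classical all_reals all_analysis.
From mathcomp Require Import measurable_realfun ring lra.

Import Order.TTheory GRing.Theory Num.Theory.
Import numFieldNormedType.Exports.

Local Open Scope classical_set_scope.
Local Open Scope ring_scope.

(** Write g for the function z |-> K ((x - z) / h^(1/d)), mu for the law of the
observations, S g for the sum of g over the first n observations. Then
<<
  f_{n,h}(x) - f(x) = (S g - n mu(g)) / (n h)  +  (mu(g) / h - f(x)).
>>
The bias mu(g) / h - f(x) is, after the substitution z = x - h^(1/d) s, the
integral of K(s) (f (x - h^(1/d) s) - f(x)), because K has integral 1. A
uniformly continuous density is bounded, so this is small uniformly in x as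
soon as h is small ([kernel_bias_small]): on a large box the increments of f
are small, and outside of it |K| has a small integral. The same substitution
gives mu(g^2) <= A h ([second_moment_kernel]).

For the random part only convergence to 0 is claimed, not a rate, and
n a_n / log n tends to infinity. It is therefore enough to know that for every
eps > 0 there is c such that, almost surely, for all large n and all g in the
class,
<<
  |S g - n mu(g)| <= c log n + eps n mu(g^2),
>>
since after division by n h >= n a_n the right-hand side is at most
c log n / (n a_n) + eps A. This inequality ([ae_deviation_le]) compares the
deviation with the second moment of g instead of a supremum over bandwidths, and
this has two advantages. It needs neither chaining nor a concentration
inequality: a covering of the class at the single scale 1/n suffices. And it
passes to pointwise limits ([deviation_le_limit]), so it may be proved for the
countable subclass only, although the bandwidths of the approximating functions
are not controlled.

The inequality is proved by Vapnik-Chervonenkis symmetrization. The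
observations X_n, ..., X_{2n-1} serve as a ghost sample: a large deviation of
the sample yields, with probability at least 1/2, a large difference between
sample and ghost sample ([prob_bigcup_le_ghost]). Exchanging X_i and X_{n+i}
does not change the joint law, so the probability is bounded by the largest
proportion of sign vectors that produce a large signed sum at 2n fixed points
([prob_le_swap_card]). At these points the class reduces to polynomially many
of its members, by the covering hypothesis for their empirical measure
([sample_covered_uniform]), and each member is handled by an exponential moment
([card_signed_deviation]). The bound obtained in this way also contains the
empirical second moment of g; applying it to the squares g^2 removes that term,
and the Borel-Cantelli lemma concludes. *)

(** * Signed sums *)

Section rademacher.
Context {R : realType}.

(** An elementary weakening of cosh x <= exp (x^2 / 2): on |y| <= 1/2 one has
e^y <= 1 / (1 - y) <= 1 + y + 2 y^2, and the linear terms at x and - x cancel. *)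
Lemma expR_symm_le (x : R) : `|x| <= 1 / 2 ->
  expR x + expR (- x) <= 2 * expR (2 * x ^+ 2).
Proof.
have half (y : R) : `|y| <= 1 / 2 -> expR y <= 1 + y + 2 * y ^+ 2.
  rewrite ler_norml => /andP[y1 y2].
  have : 1 - y <= expR (- y) by rewrite expR_ge1Dx.
  rewrite expRN => H.
  have -> : expR y = (expR y)^-1^-1 by rewrite invrK.
  rewrite -[leRHS]invrK lef_pV2 ?posrE ?invr_gt0 ?expR_gt0//; last by nra.
  apply: le_trans H; rewrite -[leLHS]div1r ler_pdivrMr; nra.
move=> x2; have := half x x2; have := half (- x); rewrite normrN => /(_ x2).
have := @expR_ge1Dx R (2 * x ^+ 2).
nra.
Qed.

Definition signed (n : nat) (s : {ffun 'I_n -> bool}) (d : 'I_n -> R) : R :=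
  \sum_(i < n) (-1) ^+ s i * d i.

(** The exponential turns the sum over sign vectors into a product over the
coordinates, by distributivity. *)
Lemma sum_expR_signed n (d : 'I_n -> R) (l : R) :
  (forall i, `|l * d i| <= 1 / 2) ->
  \sum_(s : {ffun 'I_n -> bool}) expR (l * signed n s d) <=
  2 ^+ n * expR (2 * l ^+ 2 * \sum_(i < n) d i ^+ 2).
Proof.
move=> ld.
have -> : \sum_(s : {ffun 'I_n -> bool}) expR (l * signed n s d) =
    \prod_(i < n) \sum_(b : bool) expR (l * ((-1) ^+ b * d i)).
  rewrite bigA_distr_bigA/=; apply: eq_bigr => s _.
  by rewrite /signed mulr_sumr expR_sum.
have -> : 2 ^+ n * expR (2 * l ^+ 2 * \sum_(i < n) d i ^+ 2) =
    \prod_(i < n) (2 * expR (2 * (l * d i) ^+ 2)).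
  rewrite big_split/= prodr_const card_ord -expR_sum mulr_sumr.
  congr (_ * expR _); apply: eq_bigr => i _; ring.
apply: ler_prod => i _; rewrite sumr_ge0 => [/=|b _]; last exact: expR_ge0.
rewrite big_bool/= expr1 expr0 mul1r mulN1r mulrN addrC.
exact: expR_symm_le.
Qed.

(** Chernoff's bound for a Rademacher sum. The signs are uniform on a finite set,
so the bound is a count and needs no probability space for them. *)
Lemma card_signed_gt n (d : 'I_n -> R) (l u : R) : 0 <= l ->
  (forall i, `|l * d i| <= 1 / 2) ->
  #|[pred s : {ffun 'I_n -> bool} | u < `|signed n s d|]|%:R <=
  2 ^+ n * (2 * expR (2 * l ^+ 2 * \sum_(i < n) d i ^+ 2 - l * u)).
Proof.
move=> l0 ld; rewrite -sum1_card natr_sum.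
apply: (@le_trans _ _ (\sum_(s : {ffun 'I_n -> bool})
   expR (- (l * u)) * (expR (l * signed n s d) + expR (- l * signed n s d)))).
  rewrite [leRHS](bigID (fun s => s \in [pred s | u < `|signed n s d|]))/=.
  rewrite -[leLHS]addr0 lerD//; last first.
    by apply: sumr_ge0 => s _; rewrite mulr_ge0 ?addr_ge0 ?expR_ge0.
  apply: ler_sum => s; rewrite inE => us.
  rewrite mulrDr -!expRD.
  have [s0|s0] := leP 0 (signed n s d).
    rewrite -[leLHS]addr0 lerD ?expR_ge0// -expR0 ler_expR addrC -mulrBr mulr_ge0//.
    by rewrite subr_ge0 -(ger0_norm s0) ltW.
  rewrite -[leLHS]add0r lerD ?expR_ge0// -expR0 ler_expR addrC mulNr -mulrN -mulrBr.
  by rewrite mulr_ge0// subr_ge0 -(ltr0_norm s0) ltW.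
rewrite -mulr_sumr big_split/= expRD.
have H1 := sum_expR_signed n d l ld.
have H2 := sum_expR_signed n d (- l).
rewrite sqrrN in H2.
have {}H2 : \sum_(s : {ffun 'I_n -> bool}) expR (- l * signed n s d) <=
    2 ^+ n * expR (2 * l ^+ 2 * \sum_(i < n) d i ^+ 2).
  by apply: H2 => i; rewrite mulNr normrN.
apply: le_trans (ler_wpM2l (expR_ge0 _) (lerD H1 H2)) _.
by rewrite le_eqVlt; apply/orP; left; apply/eqP; ring.
Qed.

End rademacher.

Section signed_cover.
Context {R : realType} {T : Type}.

Lemma card_exists_le (S : finType) N (p : 'I_N -> pred S) (q : pred S) :
  (forall s, q s -> exists j, p j s) ->
  (#|[pred s | q s]| <= \sum_(j < N) #|[pred s | p j s]|)%N.
Proof.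
move=> qp; under eq_bigr do rewrite -sum1_card big_mkcond/=.
rewrite exchange_big/= -sum1_card big_mkcond/=; apply: leq_sum => s _.
rewrite inE; case: ifPn => // /qp[j pjs].
by rewrite (bigD1 j)//= inE pjs.
Qed.

(** At the 2n points every g k agrees up to rho with one of the N chosen members
of the family, so a sign vector that is bad for some k is bad for one of these
N members with slightly smaller constants. For one member the threshold
eps / 16 V + t / 8 contains the sum V of the squares, which also controls the
quadratic term of Chernoff's exponent: for l = eps / 64 the two contributions of
V cancel and exp (- eps t / 512) is left. *)
Lemma card_signed_deviation n N (x y : 'I_n -> T) (g : nat -> T -> R)
    (c : 'I_N -> nat) (kappa rho eps t : R) :
  0 < eps -> eps * kappa <= 16 -> 0 <= rho ->
  (forall k z, `|g k z| <= kappa) ->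
  (forall k, exists j, forall i, `|g k (x i) - g (c j) (x i)| <= rho /\
                                 `|g k (y i) - g (c j) (y i)| <= rho) ->
  n%:R * (2 * rho + eps / 4 * rho ^+ 2) <= t / 8 ->
  #|[pred s : {ffun 'I_n -> bool} | `[< exists k,
      eps / 8 * (\sum_(i < n) (g k (x i) ^+ 2 + g k (y i) ^+ 2)) + t / 4 <
      `|signed n s (fun i => g k (x i) - g k (y i))| >] ]|%:R <=
  2 ^+ n * (2 * N%:R * expR (- (eps * t / 512))) :> R.
Proof.
move=> e0 ek r0 gk cov nt.
have sumE (a : R) : n%:R * a = \sum_(i < n) a.
  by rewrite sumr_const card_ord mulr_natl.
pose V k := \sum_(i < n) (g k (x i) ^+ 2 + g k (y i) ^+ 2).
pose u k := eps / 16 * V k + t / 8.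
pose D k s := signed n s (fun i => g k (x i) - g k (y i)).
pose p (j : 'I_N) s := u (c j) < `|D (c j) s|.
apply: (@le_trans _ _ (\sum_(j < N) #|[pred s | p j s]|)%:R).
  rewrite ler_nat; apply: card_exists_le => s /asboolP[k].
  rewrite -/(V k) -/(D k s) => Hk.
  have [j Hj] := cov k; exists j; rewrite /p /u.
  have HV : V k >= V (c j) / 2 - n%:R * (2 * rho ^+ 2).
    rewrite /V mulr_suml sumE -sumrB; apply: ler_sum => i _.
    have sq (a b : R) : `|a - b| <= rho -> b ^+ 2 / 2 - rho ^+ 2 <= a ^+ 2.
      rewrite -ler_sqr ?nnegrE// real_normK ?num_real// => ab.
      by have := sqr_ge0 (2 * a - b); nra.
    by have [/sq ? /sq ?] := Hj i; lra.
  have HD : `|D k s| <= `|D (c j) s| + n%:R * (2 * rho).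
    have -> : D k s = D (c j) s + (D k s - D (c j) s) by ring.
    apply: le_trans (ler_normD _ _) _; rewrite lerD2l.
    rewrite /D /signed -sumrB.
    apply: le_trans (ler_norm_sum _ _ _) _.
    rewrite sumE; apply: ler_sum => i _.
    rewrite -mulrBr normrM normrX normrN1 expr1n !mul1r.
    have [] := Hj i; rewrite !ler_norml => /andP[? ?] /andP[? ?].
    by apply/andP; split; lra.
  have ev : eps * (V (c j) / 2 - n%:R * (2 * rho ^+ 2)) <= eps * V k.
    by rewrite ler_wpM2l// ltW.
  nra.
rewrite natr_sum.
apply: (@le_trans _ _ (\sum_(j < N) 2 ^+ n * (2 * expR (- (eps * t / 512))))).
  apply: ler_sum => j _.
  apply: le_trans (card_signed_gt n _ (eps / 64) (u (c j)) _ _) _.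
  - by rewrite divr_ge0// ltW.
  - move=> i; rewrite normrM ger0_norm; last by rewrite divr_ge0// ltW.
    have : `|g (c j) (x i) - g (c j) (y i)| <= 2 * kappa.
      by apply: le_trans (ler_normB _ _) _; rewrite mulr2n mulrDl mul1r lerD.
    by move=> h; have := ler_wpM2l (ltW e0) h; lra.
  rewrite ler_wpM2l ?exprn_ge0// ler_wpM2l// ler_expR.
  have HW : \sum_(i < n) (g (c j) (x i) - g (c j) (y i)) ^+ 2 <= 2 * V (c j).
    rewrite mulr_sumr; apply: ler_sum => i _.
    by have := sqr_ge0 (g (c j) (x i) + g (c j) (y i)); nra.
  have e2 : 0 <= eps * eps by rewrite -expr2 sqr_ge0.
  have := ler_wpM2l e2 HW; rewrite /u.
  nra.
rewrite sumr_const card_ord -[leLHS]mulr_natr.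
by rewrite le_eqVlt; apply/orP; left; apply/eqP; ring.
Qed.

End signed_cover.

(** * Joint laws of i.i.d. variables *)

Section tuple_measure.
Context {d} {T : measurableType d} {R : realType}.

Definition tuple_box {m} (B : 'I_m -> set T) : set (m.-tuple T) :=
  [set t | forall i, B i (tnth t i)].

Definition tuple_boxes m : set (set (m.-tuple T)) :=
  [set tuple_box B | B in [set B : 'I_m -> set T | forall i, measurable (B i)]].

Lemma measurable_tuple_boxes m :
  @measurable _ (m.-tuple T) = <<s tuple_boxes m >>.
Proof.
apply/seteqP; split.
  apply: smallest_sub; first exact: smallest_sigma_algebra.
  rewrite -bigcup_seq; apply: bigcup_sub => /= i _ _ [A mA <-].
  apply: sub_sigma_algebra; exists (fun j => if j == i then A else setT).
    by move=> j /=; case: ifP.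
  rewrite setTI; apply/seteqP; split => t /= => [/(_ i)|At j].
    by rewrite eqxx.
  by case: eqP => [->|].
apply: smallest_sub; first exact: sigma_algebra_measurable.
move=> _ [B mB <-].
have -> : tuple_box B =
    \bigcap_(i in [set: 'I_m]) ((fun t : m.-tuple T => tnth t i) @^-1` B i).
  by apply/seteqP; split => t /= Ht i; [move=> _; exact: Ht|exact: (Ht i I)].
apply: fin_bigcap_measurable => [|i _]; first exact: finite_finset.
by rewrite -[X in measurable X]setTI; exact: measurable_tnth.
Qed.

Lemma tuple_measure_unique m (m1 m2 : {measure set (m.-tuple T) -> \bar R}) :
  (m1 setT < +oo)%E ->
  (forall B, (forall i, measurable (B i)) ->
    m1 (tuple_box B) = m2 (tuple_box B)) ->
  forall A, measurable A -> m1 A = m2 A.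
Proof.
move=> fin1 m12; apply: (measure_unique (tuple_boxes m) (fun=> setT)) => //.
- exact: measurable_tuple_boxes.
- move=> _ _ [B mB <-] [C mC <-]; exists (fun i => B i `&` C i).
    by move=> i /=; exact: measurableI.
  by apply/seteqP; split => t /= => [H|[H1 H2] i]; [split => i; have [] := H i|].
- move=> _; exists (fun=> setT); first by move=> i /=.
  by apply/seteqP; split.
- by apply/seteqP; split => // t _; exists 0%N.
- by move=> _ [B mB <-]; exact: m12.
Qed.

End tuple_measure.

Section iid.
Context {disp disp' : measure_display} {Omega : measurableType disp}
  {T : measurableType disp'} {R : realType} (P : probability Omega R).

(** In the variable A both sides are finite measures, so the sets A may be
restricted to a generating class that is stable under intersection. *)
Lemma independent_of_tuple (E : set Omega) m (Y : {RV P >-> m.-tuple T}) :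
  measurable E ->
  (forall B, (forall i, measurable (B i)) ->
    P (E `&` Y @^-1` tuple_box B) = (P E * P (Y @^-1` tuple_box B))%E) ->
  forall A, measurable A -> P (E `&` Y @^-1` A) = (P E * P (Y @^-1` A))%E.
Proof.
move=> mE EB A mA.
have c0 : 0 <= fine (P E) by rewrite fine_ge0.
have -> : (P E * P (Y @^-1` A))%E =
    mscale (NngNum c0) (distribution P Y) A.
  by rewrite /mscale/= fineK ?fin_num_measure.
have -> : P (E `&` Y @^-1` A) = pushforward (mrestr P mE) Y A.
  by rewrite /pushforward /mrestr setIC.
apply: tuple_measure_unique => //=.
- rewrite /pushforward /mrestr (le_lt_trans (probability_le1 _ _)) ?ltry//.
  by rewrite preimage_setT setTI.
- move=> B mB; rewrite /pushforward /mrestr /mscale/= setIC EB//.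
  by rewrite fineK ?fin_num_measure.
Qed.

Variable X : nat -> {RV P >-> T}.

(** pi = id gives the sample, pi = addn n the ghost sample that follows it, and a
permutation pi of the first 2n indices an exchange between the two. *)
Definition block (pi : nat -> nat) m (w : Omega) : m.-tuple T :=
  [tuple X (pi i) w | i < m].

Lemma measurable_block pi m : measurable_fun [set: Omega] (block pi m).
Proof.
apply/measurable_fun_tnthP => i; apply: (eq_measurable_fun (X (pi i))) => //.
by move=> w _ /=; rewrite tnth_mktuple.
Qed.

HB.instance Definition _ pi m :=
  isMeasurableFun.Build _ _ _ _ (block pi m) (measurable_block pi m).

Hypothesis indep : mutually_independent P X.
Hypothesis ident : identically_distributed P X.

Lemma prob_block_box pi m (B : 'I_m -> set T) : injective pi ->
  (forall i, measurable (B i)) ->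
  P (block pi m @^-1` tuple_box B) =
  (\prod_(i < m) distribution P (X 0%N) (B i))%E.
Proof.
move=> pi_inj mB.
pose J := [fset pi (i : 'I_m) | i in 'I_m]%fset.
pose C j := \bigcap_(i in [set i : 'I_m | pi i = j]) B i.
have Cpi (i : 'I_m) : C (pi i) = B i.
  apply/seteqP; split => z /= => [|Bz k /= /pi_inj/val_inj -> //].
  by apply.
have := indep J C; rewrite big_imfset/=; last by move=> i j _ _ /pi_inj/val_inj.
rewrite big_enum/= => H.
transitivity (\prod_(i in 'I_m) P (X (pi i) @^-1` C (pi i)))%E; last first.
  by apply: eq_bigr => i _; rewrite Cpi -(ident (pi i)).
rewrite -H; last first.
  by move=> _ /imfsetP[i _ ->] /=; rewrite Cpi.
congr (P _); apply/seteqP; split => w /=.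
  move=> Hw _ /imfsetP[i _ ->] /=; rewrite Cpi.
  by have := Hw i; rewrite tnth_mktuple.
move=> Hw i; rewrite tnth_mktuple -Cpi.
by apply: (Hw (pi i)); apply/imfsetP; exists i.
Qed.

(** Any m distinct variables of an i.i.d. sequence have the same joint law; this
is the invariance under exchanges that symmetrization relies on. *)
Lemma prob_block_inj pi m (A : set (m.-tuple T)) : injective pi ->
  measurable A -> P (block pi m @^-1` A) = P (block id m @^-1` A).
Proof.
move=> pi_inj mA.
rewrite -[LHS]/(distribution P (block pi m) A).
rewrite -[RHS]/(distribution P (block id m) A).
apply: tuple_measure_unique => //.
  by rewrite (le_lt_trans (probability_le1 _ _)) ?ltry.
by move=> B mB; apply: etrans (prob_block_box pi m B pi_inj mB) _;
  exact/esym/(prob_block_box id m B (@inj_id _) mB).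
Qed.

(** Independence is known for products of events of single variables; it is
extended to arbitrary events first in the ghost sample, then in the sample. *)
Lemma block_independent n (A B : set (n.-tuple T)) :
  measurable A -> measurable B ->
  P (block id n @^-1` A `&` block (addn n) n @^-1` B) =
  (P (block id n @^-1` A) * P (block (addn n) n @^-1` B))%E.
Proof.
move=> mA mB.
have mblock pi C : measurable C -> measurable (block pi n @^-1` C).
  by move=> mC; rewrite -[X in measurable X]setTI; exact: measurable_block.
apply: (independent_of_tuple _ n (block (addn n) n) _ _ B mB) => [|{B mB} B mB].
  exact: mblock.
rewrite setIC muleC.
have mbox : measurable (tuple_box B).
  by rewrite measurable_tuple_boxes; apply: sub_sigma_algebra; exists B.
apply: (independent_of_tuple _ n (block id n) _ _ A mA) => [|]; first exact: mblock.
move=> C mC.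
rewrite (prob_block_box id)// ?(prob_block_box (addn n))//; last exact: addnI.
pose D (i : 'I_(n + n)) := match fintype.split i with inl j => C j | inr j => B j end.
have Dl j : D (lshift n j) = C j by rewrite /D (unsplitK (inl j)).
have Dr j : D (rshift n j) = B j by rewrite /D (unsplitK (inr j)).
have mD i : measurable (D i) by rewrite /D; case: fintype.split.
rewrite muleC (_ : _ `&` _ = block id (n + n) @^-1` tuple_box D).
  rewrite (prob_block_box id)// big_split_ord/=; congr (_ * _)%E;
    by apply: eq_bigr => i _; rewrite (Dl, Dr).
apply/seteqP; split => w /= => [[H1 H2] i|H].
  rewrite tnth_mktuple; case: (fintype.split_ordP i) => j ->.
    by have := H2 j; rewrite tnth_mktuple Dl.
  by have := H1 j; rewrite tnth_mktuple Dr.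
split=> i; rewrite tnth_mktuple.
  by have := H (rshift n i); rewrite tnth_mktuple Dr.
by have := H (lshift n i); rewrite tnth_mktuple Dl.
Qed.

End iid.

(** * First and second moments *)

Section bounded_measurable.
Context {d : measure_display} {T : measurableType d} {R : realType}.

(** Bounded measurable functions are integrable for every probability measure and
stable under all the operations below, which takes care of the integrability
conditions in moment computations. *)
Definition bounded_measurable (f : T -> R) :=
  measurable_fun [set: T] f /\ exists k, forall x, `|f x| <= k.

Lemma bounded_measurable_cst c : bounded_measurable (fun=> c).
Proof. by split; [exact: measurable_cst|exists `|c|]. Qed.

Lemma bounded_measurableD f g : bounded_measurable f -> bounded_measurable g ->
  bounded_measurable (fun x => f x + g x).
Proof.
move=> [mf [k fk]] [mg [l gl]]; split; first exact: measurable_funD.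
by exists (k + l) => x; apply: le_trans (ler_normD _ _) _; exact: lerD.
Qed.

Lemma bounded_measurableM f g : bounded_measurable f -> bounded_measurable g ->
  bounded_measurable (fun x => f x * g x).
Proof.
move=> [mf [k fk]] [mg [l gl]]; split; first exact: measurable_funM.
by exists (k * l) => x; rewrite normrM ler_pM.
Qed.

Lemma bounded_measurableX f n : bounded_measurable f ->
  bounded_measurable (fun x => f x ^+ n).
Proof.
move=> bf; elim: n => [|n IHn]; first exact: bounded_measurable_cst.
by under eq_fun do rewrite exprS; exact: bounded_measurableM.
Qed.

Lemma bounded_measurable_sum m (f : 'I_m -> T -> R) :
  (forall i, bounded_measurable (f i)) ->
  bounded_measurable (fun x => \sum_(i < m) f i x).
Proof.
move=> bf; elim: m => [|m IHm] in f bf *.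
  by under eq_fun do rewrite big_ord0; exact: bounded_measurable_cst.
under eq_fun do rewrite big_ord_recr; apply: bounded_measurableD => //.
exact: IHm.
Qed.

Lemma bounded_measurable_integrable (Q : probability T R) f :
  bounded_measurable f -> Q.-integrable [set: T] (EFin \o f).
Proof.
move=> [mf [k fk]]; apply: measurable_bounded_integrable => //.
  by rewrite (le_lt_trans (probability_le1 _ _)) ?ltry.
exists k; split; first exact: num_real.
by move=> y ky x _ /=; rewrite (le_trans (fk x))// ltW.
Qed.

Lemma Rintegral_prob_cst (Q : probability T R) c : \int[Q]_x c = c.
Proof. by rewrite Rintegral_cst//= probability_setT mulr1. Qed.

Lemma EFin_Rintegral (Q : probability T R) f : bounded_measurable f ->
  (\int[Q]_x f x)%:E = (\int[Q]_x (f x)%:E)%E.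
Proof.
move=> bf; rewrite /Rintegral fineK//.
exact/integrable_fin_num/bounded_measurable_integrable.
Qed.

Lemma Rintegral_sum (Q : probability T R) m (f : 'I_m -> T -> R) :
  (forall i, bounded_measurable (f i)) ->
  \int[Q]_x (\sum_(i < m) f i x) = \sum_(i < m) \int[Q]_x f i x.
Proof.
move=> bf; elim: m => [|m IHm] in f bf *.
  under eq_Rintegral do rewrite big_ord0.
  by rewrite Rintegral_cst// mul0r big_ord0.
under eq_Rintegral do rewrite big_ord_recr/=.
rewrite RintegralD//; first by rewrite big_ord_recr/= IHm.
- by apply: bounded_measurable_integrable; exact: bounded_measurable_sum.
- exact: bounded_measurable_integrable.
Qed.

(** Markov's inequality at level 1. *)
Lemma prob_ge1_le (Q : probability T R) f : bounded_measurable f ->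
  (forall x, 0 <= f x) -> (Q [set x | (1 <= f x)%R] <= (\int[Q]_x f x)%:E)%E.
Proof.
move=> bf f0; rewrite EFin_Rintegral//.
have mf := bf.1.
have m1 : measurable [set x | 1 <= f x].
  rewrite (_ : [set _ | _] = [set: T] `&` f @^-1` `[1, +oo[).
    by apply: mf => //; exact: measurable_itv.
  by apply/seteqP; split => x /=; rewrite in_itv/= andbT => //; case.
rewrite -[X in Q X]setIT -integral_indic//; apply: ge0_le_integral => //.
- by apply/measurable_EFinP; exact: measurable_indic.
- exact/measurable_EFinP.
- by move=> x _; rewrite lee_fin indicE; case: (boolP (_ \in _)) => [/set_mem|].
Qed.

End bounded_measurable.

Section moments.
Context {disp disp' : measure_display} {Omega : measurableType disp}
  {T : measurableType disp'} {R : realType} (P : probability Omega R).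
Variable X : nat -> {RV P >-> T}.
Hypothesis indep : mutually_independent P X.
Hypothesis ident : identically_distributed P X.
Local Notation mu := (distribution P (X 0%N)).

Lemma bounded_measurable_comp (Y : {RV P >-> T}) (g : T -> R) :
  bounded_measurable g -> bounded_measurable (fun w => g (Y w)).
Proof.
move=> [mg [k gk]]; split; first exact: measurableT_comp.
by exists k.
Qed.

Lemma Rintegral_ident i (g : T -> R) : bounded_measurable g ->
  \int[P]_w g (X i w) = \int[mu]_x g x.
Proof.
move=> bg; have bgX := bounded_measurable_comp (X i) g bg.
apply: EFin_inj; rewrite !EFin_Rintegral//.
rewrite -[LHS](@integral_distribution _ _ _ _ _ P (X i) (EFin \o g)).
- by apply: eq_measure_integral => /= A mA _; exact: ident.
- by apply/measurable_EFinP; case: bg.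
- exact: bounded_measurable_integrable.
Qed.

(** The joint law of two of the variables is the product of their laws, so
Fubini's theorem applies. *)
Lemma Rintegral_indepM i j (g : T -> R) : i != j -> bounded_measurable g ->
  \int[P]_w (g (X i w) * g (X j w)) = (\int[mu]_x g x) ^+ 2.
Proof.
move=> ij bg.
have mY : measurable_fun [set: Omega] (fun w => (X i w, X j w)).
  exact: measurable_fun_pair.
pose Y : {mfun Omega >-> (T * T)%type} := HB.pack (fun w => (X i w, X j w))
  (isMeasurableFun.Build _ _ _ _ _ mY).
pose h (z : T * T) := g z.1 * g z.2.
have bh : bounded_measurable h.
  apply: bounded_measurableM; case: bg => mg [k gk].
    by split; [exact: measurableT_comp|exists k].
  by split; [exact: measurableT_comp|exists k].
have bhY : bounded_measurable (fun w => h (Y w)).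
  by apply: bounded_measurableM; exact: bounded_measurable_comp.
have law A B : measurable A -> measurable B ->
    distribution P Y (A `*` B) = (mu A * mu B)%E.
  move=> mA mB.
  have := indep [fset i; j]%fset (fun k => if k == i then A else B).
  rewrite big_fsetU1/= ?inE// big_seq_fset1 eqxx eq_sym (negbTE ij).
  rewrite -(ident i A)// -(ident j B)// => <-; last by move=> k _; case: ifP.
  congr (P _); apply/seteqP; split => w /=.
    move=> [Aw Bw] k; rewrite /= in_fset2 => /orP[/eqP ->|/eqP ->].
      by rewrite eqxx.
    by rewrite eq_sym (negbTE ij).
  move=> H; split.
    by have := H i; rewrite /= in_fset2 eqxx; exact.
  by have := H j; rewrite /= in_fset2 eqxx orbT eq_sym (negbTE ij); exact.
apply: EFin_inj; rewrite (EFin_Rintegral P (fun w => h (Y w)))//.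
rewrite -[LHS](@integral_distribution _ _ _ _ _ P Y (EFin \o h)); last 2 first.
- by apply/measurable_EFinP; case: bh.
- exact: bounded_measurable_integrable.
transitivity (\int[(mu \x mu)%E]_z (EFin \o h) z)%E.
  by apply: eq_measure_integral => A mA _; exact/esym/product_measure_unique.
rewrite -integral12_prod_meas1; last first.
  apply: measurable_bounded_integrable => //=.
  - rewrite -setXTT product_measure1E//.
    apply: (@le_lt_trans _ _ (1 * 1)%E); last by rewrite mule1 ltry.
    by apply: lee_pmul => //; exact: (@probability_le1 _ _ _ mu).
  - by case: bh.
  - case: bh => _ [k hk]; exists k; split; first exact: num_real.
    by move=> y ky x _ /=; rewrite (le_trans (hk x))// ltW.
transitivity (\int[mu]_x (g x * \int[mu]_y g y)%:E)%E.
  apply: eq_integral => x _; rewrite -RintegralZl//; last first.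
    exact: bounded_measurable_integrable.
  rewrite EFin_Rintegral//.
  by apply: bounded_measurableM => //; exact: bounded_measurable_cst.
rewrite -EFin_Rintegral; last first.
  by apply: bounded_measurableM => //; exact: bounded_measurable_cst.
rewrite RintegralZr//; last exact: bounded_measurable_integrable.
Qed.

(** The variance of a sum of n independent copies is n times the variance of one
of them, hence at most n times its second moment: the mixed terms of the square
vanish. *)
Lemma second_moment_sum_le n (pi : nat -> nat) (g : T -> R) : injective pi ->
  bounded_measurable g ->
  \int[P]_w ((\sum_(i < n) g (X (pi i) w) - n%:R * \int[mu]_x g x) ^+ 2) <=
  n%:R * \int[mu]_x (g x ^+ 2).
Proof.
move=> pi_inj bg; set m := \int[mu]_x g x.
pose u x := g x - m.
have bu : bounded_measurable u.
  by apply: bounded_measurableD => //; exact: bounded_measurable_cst.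
have u0 : \int[mu]_x u x = 0.
  rewrite RintegralB//; [|exact: bounded_measurable_integrable..|].
    by rewrite Rintegral_prob_cst -/m subrr.
  exact/bounded_measurable_integrable/bounded_measurable_cst.
have buX i : bounded_measurable (fun w => u (X (pi i) w)).
  exact: bounded_measurable_comp.
have -> : \int[P]_w ((\sum_(i < n) g (X (pi i) w) - n%:R * m) ^+ 2) =
    \int[P]_w (\sum_(i < n) \sum_(j < n) u (X (pi i) w) * u (X (pi j) w)).
  apply: eq_Rintegral => w _.
  have -> : n%:R * m = \sum_(i < n) m by rewrite sumr_const card_ord mulr_natl.
  rewrite -sumrB expr2 mulr_suml; apply: eq_bigr => i _.
  by rewrite mulr_sumr.
rewrite Rintegral_sum; last first.
  move=> i; apply: bounded_measurable_sum => j; exact: bounded_measurableM.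
rewrite mulr_natl -[n in _ *+ n]card_ord -sumr_const; apply: ler_sum => i _.
rewrite Rintegral_sum; last by move=> j; exact: bounded_measurableM.
rewrite (bigD1 i)//= big1 ?addr0; last first.
  move=> j ji; rewrite Rintegral_indepM ?u0 ?expr0n//.
  by apply: contra ji => /eqP/pi_inj/val_inj ->.
rewrite (Rintegral_ident (pi i) (fun x => u x * u x)); last first.
  exact: bounded_measurableM.
have -> : \int[mu]_x (u x * u x) =
    \int[mu]_x (g x ^+ 2 - ((2 * m) * u x + m ^+ 2)).
  by apply: eq_Rintegral => x _; rewrite /u; ring.
have bgg : bounded_measurable (fun x => g x ^+ 2) by exact: bounded_measurableX.
have bmu : bounded_measurable (fun x => 2 * m * u x).
  by apply: bounded_measurableM => //; exact: bounded_measurable_cst.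
have bmm : bounded_measurable (fun _ : T => m ^+ 2) by exact: bounded_measurable_cst.
rewrite RintegralB//; [|exact: bounded_measurable_integrable|]; last first.
  by apply: bounded_measurable_integrable; exact: bounded_measurableD.
rewrite gerBl// RintegralD//; [|exact: bounded_measurable_integrable..].
rewrite RintegralZl//; last exact: bounded_measurable_integrable.
by rewrite u0 mulr0 add0r Rintegral_prob_cst sqr_ge0.
Qed.

End moments.

(** * Symmetrization *)

(** An involution of the indices: the sign vector selects which of the
transpositions of i and n + i are performed. *)
Definition swap (n : nat) (s : {ffun 'I_n -> bool}) (i : nat) : nat :=
  let b j := if insub j is Some k then s k else false in
  if (i < n)%N then if b i then (n + i)%N else i
  else if (i < n + n)%N then if b (i - n)%N then (i - n)%N else i else i.

Lemma swap_inj n s : injective (swap n s).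
Proof.
apply: (can_inj (g := swap n s)) => i; rewrite /swap.
have [i_n|n_i] := ltnP i n.
  case: (boolP (if insub i is Some k then s k else false)) => b; last first.
    by rewrite i_n (negbTE b).
  by rewrite ltnNge leq_addr/= ltn_add2l i_n addKn b.
have [i_nn|nn_i] := ltnP i (n + n).
  have i' : (i - n < n)%N by rewrite ltn_subLR.
  case: (boolP (if insub (i - n)%N is Some k then s k else false)) => b.
    by rewrite i' b subnKC.
  rewrite ltnNge n_i/= i_nn (negbTE b)//.
by rewrite ltnNge n_i/= ltnNge nn_i.
Qed.

Lemma swap_lshift n s (i : 'I_n) : swap n s i = if s i then (n + i)%N else i.
Proof. by rewrite /swap ltn_ord valK. Qed.

Lemma swap_rshift n s (i : 'I_n) :
  swap n s (n + i) = if s i then i : nat else (n + i)%N.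
Proof. by rewrite /swap ltnNge leq_addr/= ltn_add2l ltn_ord addKn valK. Qed.

Section symmetrization.
Context {disp disp' : measure_display} {Omega : measurableType disp}
  {T : measurableType disp'} {R : realType} (P : probability Omega R).
Variable X : nat -> {RV P >-> T}.
Hypothesis indep : mutually_independent P X.
Hypothesis ident : identically_distributed P X.
Local Notation mu := (distribution P (X 0%N)).
Local Notation block := (block P X).

Lemma measurable_preimage_block pi m (A : set (m.-tuple T)) : measurable A ->
  measurable (block pi m @^-1` A).
Proof.
by move=> mA; rewrite -[X in measurable X]setTI; exact: measurable_block.
Qed.

(** Symmetrization. The event that k is the first index with A k depends on the
sample only, so it is independent of D k, and intersecting it with D k costs at
most a factor 2. As these events are disjoint for distinct k, the factor is paid
once for the whole union. *)
Lemma prob_bigcup_le_ghost n (A D : nat -> set (n.-tuple T)) :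
  (forall k, measurable (A k)) -> (forall k, measurable (D k)) ->
  (forall k, ((1 / 2)%:E <= P (block (addn n) n @^-1` D k))%E) ->
  (P (\bigcup_k (block id n @^-1` A k)) <=
   2%:E * P (\bigcup_k (block id n @^-1` A k `&`
                        block (addn n) n @^-1` D k)))%E.
Proof.
move=> mA mD D2.
pose B := seqDU A.
have mB k : measurable (B k) by apply: seqDU_measurable.
have tB : trivIset setT (fun k => block id n @^-1` B k).
  apply/trivIsetP => i j _ _ ij; rewrite -preimage_setI.
  by move/trivIsetP : (@trivIset_seqDU _ A) => /(_ i j I I ij) ->; rewrite preimage_set0.
rewrite -preimage_bigcup seqDU_bigcup_eq preimage_bigcup.
rewrite measure_bigcup//; last first.
  by move=> k _; exact: measurable_preimage_block.
apply: (@le_trans _ _ (\sum_(k <oo | k \in [set: nat])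
    (2%:E * P (block id n @^-1` B k `&` block (addn n) n @^-1` D k)))%E).
  apply: lee_nneseries => // k _.
  rewrite (block_independent P X indep ident n _ _ (mB k) (mD k)) muleCA.
  rewrite -[leLHS]mule1 lee_wpmul2l//.
  apply: le_trans (lee_wpmul2l _ (D2 k)); last by rewrite lee_fin.
  by rewrite -EFinM lee_fin; lra.
rewrite nneseriesZl//.
rewrite lee_wpmul2l ?lee_fin// -measure_bigcup//; last first.
- apply/trivIsetP => i j _ _ ij; rewrite setIACA.
  by move/trivIsetP : tB => /(_ i j I I ij) ->; rewrite set0I.
- by move=> k _; apply: measurableI; exact: measurable_preimage_block.
apply: le_measure; rewrite ?inE.
- apply: bigcup_measurable => k _.
  by apply: measurableI; exact: measurable_preimage_block.
- apply: bigcup_measurable => k _.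
  by apply: measurableI; exact: measurable_preimage_block.
apply: subset_bigcup => k _; apply: setSI; apply: preimage_subset.
exact: subset_seqDU.
Qed.

(** Averaging the probability of A over all exchanges, which preserve the law,
turns it into the mean of the proportion of sign vectors that send the observed
points into A. *)
Lemma prob_le_swap_card n (A : set ((n + n).-tuple T)) (M : R) : measurable A ->
  (forall w, #|[pred s | `[< A (block (swap n s) (n + n) w) >] ]|%:R <=
             2 ^+ n * M) ->
  (P (block id (n + n) @^-1` A) <= M%:E)%E.
Proof.
move=> mA AM.
have mE s : measurable (block (swap n s) (n + n) @^-1` A).
  exact: measurable_preimage_block.
pose F s : Omega -> R := \1_(block (swap n s) (n + n) @^-1` A).
have F_int s : (\int[P]_w (F s w)%:E)%E = P (block id (n + n) @^-1` A).
  rewrite integral_indic// setIT.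
  exact: (prob_block_inj P X indep ident _ _ _ (@swap_inj n s) mA).
have mF s : measurable_fun [set: Omega] (F s) by exact: measurable_indic.
have : (\int[P]_w (\sum_(s : {ffun 'I_n -> bool}) (F s w)%:E) <=
        (2 ^+ n * M)%:E)%E.
  apply: (@le_trans _ _ (\int[P]_w (cst (2 ^+ n * M)%:E) w)%E); last first.
    by rewrite integral_cst//= probability_setT mule1.
  apply: ge0_le_integral => //.
  - by move=> w _; apply: sume_ge0 => s _; rewrite lee_fin.
  - by apply: emeasurable_sum => s; apply/measurable_EFinP.
  - move=> w _; rewrite sumEFin lee_fin; apply: le_trans (AM w).
    rewrite -sum1_card natr_sum [leRHS]big_mkcond/=; apply: ler_sum => s _.
    rewrite inE /F indicE; case: asboolP => H; first by rewrite mem_set.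
    by rewrite memNset.
rewrite ge0_integral_sum//; last 2 first.
- by move=> s; apply/measurable_EFinP.
- by move=> s w _; rewrite lee_fin.
rewrite (eq_bigr (fun=> P (block id (n + n) @^-1` A))) => [|s _]; last exact: F_int.
have <- : (fine (P (block id (n + n) @^-1` A)))%:E = P (block id (n + n) @^-1` A).
  by rewrite fineK// fin_num_measure//; exact: measurable_preimage_block.
rewrite sumEFin !lee_fin sumr_const card_ffun card_bool card_ord.
by rewrite -[leLHS]mulr_natl natrX ler_pM2l// exprn_gt0.
Qed.

End symmetrization.

(** * Relative deviations for a countable family *)

Lemma measurable_set_lt {d} {T : measurableType d} {R : realType}
    (f h : T -> R) : measurable_fun [set: T] f -> measurable_fun [set: T] h ->
  measurable [set x | f x < h x].
Proof.
move=> mf mh.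
rewrite (_ : [set _ | _] = [set: T] `&` (fun x => h x - f x) @^-1` `]0, +oo[).
  have mhf : measurable_fun [set: T] (fun x => h x - f x) by exact: measurable_funB.
  by apply: mhf => //; exact: measurable_itv.
apply/seteqP; split => x /=; rewrite in_itv/= andbT subr_gt0 => //.
by case.
Qed.

Section relative_deviation.
Context {disp disp' : measure_display} {Omega : measurableType disp}
  {T : measurableType disp'} {R : realType} (P : probability Omega R).
Variable X : nat -> {RV P >-> T}.
Hypothesis indep : mutually_independent P X.
Hypothesis ident : identically_distributed P X.
Local Notation mu := (distribution P (X 0%N)).
Local Notation block := (block P X).

Definition tsum {n} (g : T -> R) (t : n.-tuple T) : R :=
  \sum_(i < n) g (tnth t i).

Lemma measurable_tsum n g : measurable_fun [set: T] g ->
  measurable_fun [set: n.-tuple T] (tsum g).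
Proof.
move=> mg; rewrite /tsum.
by apply: measurable_sum => i; apply: measurableT_comp => //; exact: measurable_tnth.
Qed.

Lemma tsum_block n g pi w : tsum g (block pi n w) = \sum_(i < n) g (X (pi i) w).
Proof. by apply: eq_bigr => i _; rewrite tnth_mktuple. Qed.

(** Two requirements on the ghost sample, a small centred sum and a bounded sum
of squares, are obtained from one application of Markov's inequality: each of
the two terms has mean at most 1/4. The summand t / eps keeps the second
denominator positive when the second moment of g vanishes. *)
Lemma ghost_half n (g : T -> R) (eps t : R) : bounded_measurable g ->
  0 < eps -> 4 <= eps * t ->
  let m1 := \int[mu]_x g x in let m2 := \int[mu]_x (g x ^+ 2) in
  let D := [set x : n.-tuple T |
    (tsum g x - n%:R * m1) ^+ 2 / ((eps * (n%:R * m2) + t) / 2) ^+ 2 +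
    tsum (fun z => g z ^+ 2) x / (4 * (n%:R * m2) + t / eps) < 1] in
  measurable D /\ ((1 / 2)%:E <= P (block (addn n) n @^-1` D))%E.
Proof.
move=> bg e0 et m1 m2 D.
have t0 : 0 < t by rewrite -(pmulr_rgt0 _ e0); lra.
have m20 : 0 <= m2 by apply: Rintegral_ge0 => x _; exact: sqr_ge0.
have nm0 : 0 <= n%:R * m2 by rewrite mulr_ge0.
pose u := (eps * (n%:R * m2) + t) / 2; pose v := 4 * (n%:R * m2) + t / eps.
have u0 : 0 < u by rewrite /u divr_gt0// ltr_wpDl// mulr_ge0// ltW.
have v0 : 0 < v by rewrite /v ltr_wpDl ?divr_gt0// mulr_ge0.
have bgg : bounded_measurable (fun x => g x ^+ 2) by exact: bounded_measurableX.
have mD : measurable D.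
  apply: measurable_set_lt => //.
  apply: measurable_funD; apply: measurable_funM => //.
    apply: measurable_funX; apply: measurable_funB => //.
    by apply: measurable_tsum; case: bg.
  by apply: measurable_tsum; case: bgg.
split => //.
(* D is the event that Y < 1. *)
pose Y w := (tsum g (block (addn n) n w) - n%:R * m1) ^+ 2 / u ^+ 2 +
    tsum (fun z => g z ^+ 2) (block (addn n) n w) / v.
have bY1 : bounded_measurable
    (fun w => (\sum_(i < n) g (X (n + i)%N w) - n%:R * m1) ^+ 2).
  apply: bounded_measurableX; apply: bounded_measurableD;
    last exact: bounded_measurable_cst.
  by apply: bounded_measurable_sum => i; exact: bounded_measurable_comp.
have bY2 : bounded_measurable (fun w => \sum_(i < n) g (X (n + i)%N w) ^+ 2).
  apply: bounded_measurable_sum => i; apply: bounded_measurableX.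
  exact: bounded_measurable_comp.
have YE : Y = (fun w => (\sum_(i < n) g (X (n + i)%N w) - n%:R * m1) ^+ 2 * u ^- 2 +
   (\sum_(i < n) g (X (n + i)%N w) ^+ 2) * v^-1).
  by apply/funext => w; rewrite /Y !tsum_block.
have bY : bounded_measurable Y.
  by rewrite YE; apply: bounded_measurableD; apply: bounded_measurableM => //;
    exact: bounded_measurable_cst.
have Y0 w : 0 <= Y w.
  rewrite addr_ge0// divr_ge0 ?sqr_ge0//; last exact: ltW.
  by apply: sumr_ge0 => i _; exact: sqr_ge0.
have IY : \int[P]_w Y w <= 1 / 2.
  rewrite YE RintegralD//; last 2 first.
  - apply: bounded_measurable_integrable; apply: bounded_measurableM => //.
    exact: bounded_measurable_cst.
  - apply: bounded_measurable_integrable; apply: bounded_measurableM => //.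
    exact: bounded_measurable_cst.
  rewrite !RintegralZr//; [|exact: bounded_measurable_integrable..].
  have H1 := second_moment_sum_le P X indep ident n (addn n) g (@addnI n) bg.
  have H2 : \int[P]_w (\sum_(i < n) g (X (n + i)%N w) ^+ 2) = n%:R * m2.
    rewrite Rintegral_sum; last first.
      by move=> i; apply: bounded_measurableX; exact: bounded_measurable_comp.
    rewrite mulr_natl -[n in _ *+ n]card_ord -sumr_const; apply: eq_bigr => i _.
    exact: (Rintegral_ident P X ident (n + i)%N (fun x => g x ^+ 2)).
  rewrite H2.
  apply: (@le_trans _ _ (n%:R * m2 * u ^- 2 + n%:R * m2 * v^-1)).
    by rewrite lerD2r ler_wpM2r// invr_ge0 sqr_ge0.
  have -> : 1 / 2 = 1 / 4 + 1 / 4 :> R by field.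
  apply: lerD; rewrite ler_pdivrMr ?exprn_gt0//; rewrite /u /v.
    by have := sqr_ge0 (eps * (n%:R * m2) - t); nra.
  by have : 0 <= t / eps by [rewrite divr_ge0// ltW]; lra.
have -> : block (addn n) n @^-1` D = ~` [set w | 1 <= Y w].
  by apply/seteqP; split => w /=; rewrite /D/= -/u -/v -/(Y w) ltNge => /negP.
rewrite probability_setC//; last first.
  rewrite -[X in measurable X]setTI (_ : [set _ | _] = Y @^-1` `[1, +oo[).
    by apply: bY.1 => //; exact: measurable_itv.
  by apply/seteqP; split => w /=; rewrite in_itv/= andbT.
rewrite (_ : (1 / 2)%:E = 1 - (1 / 2)%:E)%E; last first.
  by rewrite -EFinB; congr _%:E; field.
apply: leeB => //; apply: le_trans (prob_ge1_le P Y bY Y0) _.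
by rewrite lee_fin.
Qed.


(** The deviation is measured against both the true and the empirical second
moment, because the latter is what the bound on signed sums provides. *)
Definition deviates n (eps t : R) (g : T -> R) (w : Omega) : Prop :=
  t + eps * (n%:R * \int[mu]_x (g x ^+ 2) + \sum_(i < n) g (X i w) ^+ 2) <
  `|\sum_(i < n) g (X i w) - n%:R * \int[mu]_x g x|.

(** On the intersection of a deviation of the sample with the event of
[ghost_half], the difference between the two samples exceeds
eps / 8 (V + V') + t / 4, where V and V' are their sums of squares. This
condition is, up to the signs, invariant under exchanges, so
[prob_le_swap_card] and [card_signed_deviation] bound its probability. *)
Lemma prob_deviates_le n (g : nat -> T -> R) (kappa rho eps t M : R) :
  0 < eps -> eps * kappa <= 16 -> 4 <= eps * t -> 0 <= rho ->
  (forall k, measurable_fun [set: T] (g k)) ->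
  (forall k z, `|g k z| <= kappa) ->
  (forall z : 'I_(n + n) -> T, exists N (c : 'I_N -> nat), N%:R <= M /\
    forall k, exists j, forall i, `|g k (z i) - g (c j) (z i)| <= rho) ->
  n%:R * (2 * rho + eps / 4 * rho ^+ 2) <= t / 8 ->
  measurable (\bigcup_k [set w | deviates n eps t (g k) w]) /\
  (P (\bigcup_k [set w | deviates n eps t (g k) w]) <=
    (4 * M * expR (- (eps * t / 512)))%:E)%E.
Proof.
move=> e0 ek et r0 mg gk cov nt.
have bg k : bounded_measurable (g k) by split; [|exists kappa].
pose m1 k := \int[mu]_x g k x; pose m2 k := \int[mu]_x (g k x ^+ 2).
have m20 k : 0 <= n%:R * m2 k.
  by rewrite mulr_ge0//; apply: Rintegral_ge0 => x _; exact: sqr_ge0.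
have t0 : 0 < t by rewrite -(pmulr_rgt0 _ e0); lra.
pose A k := [set x : n.-tuple T |
  t + eps * (n%:R * m2 k + tsum (fun z => g k z ^+ 2) x) <
  `|tsum (g k) x - n%:R * m1 k|].
have mgg k : measurable_fun [set: T] (fun z => g k z ^+ 2) by exact: measurable_funX.
have mA k : measurable (A k).
  apply: measurable_set_lt.
    apply: measurable_funD => //; apply: measurable_funM => //.
    by apply: measurable_funD => //; exact: measurable_tsum.
  apply: measurableT_comp => //; apply: measurable_funB => //.
  exact: measurable_tsum.
have AE k : [set w | deviates n eps t (g k) w] = block id n @^-1` A k.
  by apply/seteqP; split => w; rewrite /A/= /deviates !tsum_block.
pose D k := [set x : n.-tuple T |
  (tsum (g k) x - n%:R * m1 k) ^+ 2 / ((eps * (n%:R * m2 k) + t) / 2) ^+ 2 +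
  tsum (fun z => g k z ^+ 2) x / (4 * (n%:R * m2 k) + t / eps) < 1].
have DG k := ghost_half n (g k) eps t (bg k) e0 et.
have mD k : measurable (D k) by exact: (DG k).1.
have D2 k : ((1 / 2)%:E <= P (block (addn n) n @^-1` D k))%E.
  exact: (DG k).2.
split.
  apply: bigcup_measurable => k _; rewrite AE.
  exact: measurable_preimage_block.
under eq_bigcupr do rewrite AE.
apply: le_trans (prob_bigcup_le_ghost P X indep ident n A D mA mD D2) _.
pose lx (x : (n + n).-tuple T) i := tnth x (lshift n i).
pose rx (x : (n + n).-tuple T) i := tnth x (rshift n i).
pose B := \bigcup_k [set x : (n + n).-tuple T |
  eps / 8 * (\sum_(i < n) (g k (lx x i) ^+ 2 + g k (rx x i) ^+ 2)) + t / 4 <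
  `|\sum_(i < n) (g k (lx x i) - g k (rx x i))|].
have mgt k i : measurable_fun [set: (n + n).-tuple T] (fun x => g k (tnth x i)).
  by apply: (measurableT_comp (mg k)); exact: measurable_tnth.
have mB : measurable B.
  apply: bigcup_measurable => k _; apply: measurable_set_lt.
    apply: measurable_funD => //; apply: measurable_funM => //.
    apply: measurable_sum => i.
    by apply: measurable_funD; apply: measurable_funX; exact: mgt.
  apply: measurableT_comp => //; apply: measurable_sum => i.
  by apply: measurable_funB; exact: mgt.
have -> : (4 * M * expR (- (eps * t / 512)))%:E =
    (2%:E * (2 * M * expR (- (eps * t / 512)))%:E)%E.
  by rewrite -EFinM; congr _%:E; ring.
rewrite lee_wpmul2l ?lee_fin//.
apply: (@le_trans _ _ (P (block id (n + n) @^-1` B))).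
  apply: le_measure; rewrite ?inE.
  - apply: bigcup_measurable => k _; apply: measurableI;
      exact: measurable_preimage_block.
  - exact: measurable_preimage_block.
  move=> w [k _ [/= Ak Dk]]; exists k => //=.
  move: Ak Dk; rewrite /D /A/= !tsum_block /lx /rx.
  under [X in _ -> _ -> _ + _ < `|X|]eq_bigr do rewrite !tnth_mktuple/=.
  under [X in _ -> _ -> _ * X + _ < _]eq_bigr do rewrite !tnth_mktuple/=.
  rewrite big_split/= sumrB.
  set S := \sum_(i < n) g k (X i w); set V := \sum_(i < n) g k (X i w) ^+ 2.
  set S' := \sum_(i < n) g k (X (n + i)%N w).
  set V' := \sum_(i < n) g k (X (n + i)%N w) ^+ 2.
  move: (m20 k); set q := n%:R * m2 k; set m := n%:R * m1 k => q0.
  have V0 : 0 <= V by apply: sumr_ge0 => i _; exact: sqr_ge0.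
  have V'0 : 0 <= V' by apply: sumr_ge0 => i _; exact: sqr_ge0.
  set u := (_ / 2); set v := (4 * q + _).
  have u0 : 0 < u by rewrite /u divr_gt0// ltr_wpDl// mulr_ge0// ltW.
  have v0 : 0 < v by rewrite /v ltr_wpDl ?divr_gt0// mulr_ge0.
  move=> HA HD.
  have Hu : `|S' - m| < u.
    rewrite -ltr_sqr ?nnegrE// ?(ltW u0)// real_normK ?num_real//.
    rewrite -[ltRHS]mul1r -ltr_pdivrMr ?exprn_gt0//; apply: le_lt_trans HD.
    by rewrite lerDl divr_ge0// ltW.
  have Hv : V' < v.
    rewrite -[ltRHS]mul1r -ltr_pdivrMr//; apply: le_lt_trans HD.
    by rewrite lerDr divr_ge0 ?sqr_ge0.
  have HS : `|S - m| <= `|S - S'| + `|S' - m|.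
    by apply: le_trans (ler_normD _ _); rewrite addrA subrK.
  have Hev : eps * V' <= 4 * (eps * q) + t.
    have := ler_wpM2l (ltW e0) (ltW Hv); rewrite /v mulrDr.
    by rewrite [eps * (t / eps)]mulrC divfK ?gt_eqF//; lra.
  have eV0 : 0 <= eps * V by rewrite mulr_ge0// ltW.
  rewrite /u in Hu; lra.
apply: prob_le_swap_card => // w.
pose z (i : 'I_(n + n)) := X i w.
have [N [c [NM Hc]]] := cov z.
pose x i := z (lshift n i); pose y i := z (rshift n i).
have := card_signed_deviation n N x y g c kappa rho eps t e0 ek r0 gk.
move=> /(_ _ nt) H; apply: le_trans; last first.
  apply: (@le_trans _ _ (2 ^+ n * (2 * N%:R * expR (- (eps * t / 512))))).
    apply: H => k; have [j Hj] := Hc k; exists j => i.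
    by split; exact: Hj.
  rewrite ler_pM2l ?exprn_gt0// ler_wpM2r ?expR_ge0//.
  by rewrite ler_wpM2l.
rewrite ler_nat; apply: subset_leq_card; apply/fintype.subsetP => s; rewrite !inE.
move=> [k _] /=; rewrite /lx /rx => Hk; exists k; move: Hk.
have E i : (g k (tnth (block (swap n s) (n + n) w) (lshift n i)) ,
            g k (tnth (block (swap n s) (n + n) w) (rshift n i))) =
   if s i then (g k (y i), g k (x i)) else (g k (x i), g k (y i)).
  rewrite !tnth_mktuple /= swap_lshift swap_rshift /x /y /z.
  by case: (s i).
rewrite (eq_bigr (fun i => g k (x i) ^+ 2 + g k (y i) ^+ 2)) => [|i _]; last first.
  by have := E i; case: (s i) => -[-> ->] //; rewrite addrC.
rewrite [X in `|X|](eq_bigr (fun i => (-1) ^+ s i * (g k (x i) - g k (y i)))) // => i _.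
have := E i; case: (s i) => -[-> ->]; last by rewrite mul1r.
by rewrite expr1 mulN1r opprB.
Qed.

End relative_deviation.

(** * Almost sure bounds *)

Lemma sum_inv_sqr_le {R : realType} (m : nat) : (0 < m)%N -> forall n,
  \sum_(i < n) (m.+1 + i)%:R ^- 2 <= m%:R^-1 - (m + n)%:R^-1 :> R.
Proof.
move=> m0; elim => [|n IHn]; first by rewrite big_ord0 addn0 subrr.
rewrite big_ord_recr/=; apply: le_trans (lerD IHn (lexx _)) _.
rewrite -addrA lerD2l addnS addSn -lerBrDl opprK addrC.
have a0 : 0 < (m + n)%:R :> R by rewrite ltr0n addn_gt0 m0.
rewrite -natr1; move: (m + n)%:R a0 => a a0.
have a10 : 0 < a + 1 by lra.
have na : a != 0 by rewrite gt_eqF.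
have na1 : a + 1 != 0 by rewrite gt_eqF.
have -> : a^-1 - (a + 1)^-1 = (a * (a + 1))^-1 by field; rewrite na1 na.
by rewrite lef_pV2 ?posrE ?exprn_gt0 ?mulr_gt0// expr2 ler_wpM2r ?ltW//; lra.
Qed.

Lemma nneseries_inv_sqr_lty {R : realType} (m : nat) (K : R) : (0 < m)%N ->
  0 <= K -> (\sum_(i <oo) (K * (m.+1 + i)%:R ^- 2)%:E < +oo)%E.
Proof.
move=> m0 K0; apply: (@le_lt_trans _ _ (K * m%:R^-1)%:E); last exact: ltry.
apply: lime_le.
  by apply: is_cvg_nneseries => n _ _; rewrite lee_fin mulr_ge0// invr_ge0 sqr_ge0.
apply: nearW => n; rewrite sumEFin lee_fin -mulr_sumr ler_wpM2l// big_mkord.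
apply: le_trans (sum_inv_sqr_le m m0 n) _.
by rewrite gerBl invr_ge0.
Qed.

Section strong_law.
Context {disp disp' : measure_display} {Omega : measurableType disp}
  {T : measurableType disp'} {R : realType} (P : probability Omega R).
Variable X : nat -> {RV P >-> T}.
Hypothesis indep : mutually_independent P X.
Hypothesis ident : identically_distributed P X.
Local Notation mu := (distribution P (X 0%N)).

(** At any n points, up to an error L / n at each of them, polynomially many
members represent the whole family. The representatives belong to the family,
which makes the property inherited by the family of squares. *)
Definition sample_covered (g : nat -> T -> R) (L C : R) (p : nat) : Prop :=
  forall n, (1 < n)%N -> forall z : 'I_n -> T, exists N (c : 'I_N -> nat),
    N%:R <= C * n%:R ^+ p /\
    forall k, exists j, forall i, `|g k (z i) - g (c j) (z i)| <= L / n%:R.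

(** For t = 512 (p + 2) / eps log n the exponential factor of [prob_deviates_le]
is n^-(p + 2), which leaves n^-2 after multiplication by the number O(n^p) of
representatives; the Borel-Cantelli lemma applies. *)
Lemma ae_not_deviates (g : nat -> T -> R) (kappa eps L C : R) (p : nat) :
  0 < eps -> eps * kappa <= 16 -> 0 <= L -> 0 <= C ->
  (forall k, measurable_fun [set: T] (g k)) ->
  (forall k z, `|g k z| <= kappa) ->
  sample_covered g L C p ->
  {ae P, forall w, \forall n \near \oo, forall k,
    ~ deviates P X n eps (512 * p.+2%:R / eps * ln n%:R) (g k) w}.
Proof.
move=> e0 ek L0 C0 mg gk cov.
pose t n : R := 512 * p.+2%:R / eps * ln n%:R.
pose A n := \bigcup_k [set w | deviates P X n eps (t n) (g k) w].
(* The two side conditions of [prob_deviates_le] on t hold once log n >= thr. *)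
pose thr := Num.max 1 (8 * (L + eps * L ^+ 2) * eps).
pose m := (Num.bound (expR thr)).+1.
have m_ge n : (m.+1 <= n)%N -> thr <= ln n%:R /\ (1 < n)%N.
  move=> mn; have n1 : (1 < n)%N by apply: leq_trans mn.
  split => //; rewrite -[thr]expRK ler_ln ?posrE ?expR_gt0 ?ltr0n 1?ltnW//.
  apply: ltW; apply: lt_le_trans (archi_boundP (expR_ge0 _)) _.
  by rewrite ler_nat (leq_trans _ mn)// leqW.
have PA n : (m.+1 <= n)%N -> measurable (A n) /\
    (P (A n) <= (4 * (C * 2 ^+ p) * n%:R ^- 2)%:E)%E.
  move=> /m_ge[tn n1].
  have n0 : 0 < n%:R :> R by rewrite ltr0n ltnW.
  have l1 : 1 <= ln n%:R :> R by apply: le_trans tn; rewrite le_max lexx.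
  have p2 : 2 <= p.+2%:R :> R by rewrite ler_nat.
  have et : eps * t n = 512 * p.+2%:R * ln n%:R.
    by rewrite /t; field; rewrite gt_eqF.
  have pl : 2 <= p.+2%:R * ln n%:R :> R by nra.
  have [] := prob_deviates_le P X indep ident n g kappa (L / (n + n)%:R) eps (t n)
     (C * (n + n)%:R ^+ p) e0 ek.
  - by rewrite et; lra.
  - by rewrite divr_ge0.
  - exact: mg.
  - exact: gk.
  - by apply: cov; rewrite (leq_trans n1)// leq_addr.
  - rewrite natrD; apply: (@le_trans _ _ (L + eps * L ^+ 2)).
      have -> : n%:R * (2 * (L / (n%:R + n%:R)) +
          eps / 4 * (L / (n%:R + n%:R)) ^+ 2) = L + eps * L ^+ 2 * (16 * n%:R)^-1.
        by field; rewrite ?gt_eqF ?addr_gt0.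
      rewrite lerD2l ler_piMr// ?mulr_ge0 ?sqr_ge0 ?(ltW e0)//.
      by rewrite invf_le1 ?mulr_gt0//; have : 1 <= n%:R :> R; [rewrite ler1n ltnW|lra].
    have : 8 * (L + eps * L ^+ 2) * eps <= ln n%:R.
      by apply: le_trans tn; rewrite le_max lexx orbT.
    move=> H; rewrite -(ler_pM2l e0) [leRHS]mulrA et.
    have : ln n%:R <= p.+2%:R * ln n%:R :> R by rewrite ler_peMl; lra.
    by nra.
  move=> mA PA; split => //; apply: le_trans PA _; rewrite lee_fin.
  have -> : eps * t n / 512 = ln n%:R *+ p.+2 by rewrite et -mulr_natr; field.
  rewrite expRN -lnXn// lnK ?posrE ?exprn_gt0//.
  have -> : (n + n)%:R = 2 * n%:R :> R by rewrite natrD; ring.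
  rewrite exprMn.
  rewrite le_eqVlt; apply/orP; left; apply/eqP; rewrite !exprS.
  by field; rewrite ?gt_eqF ?exprn_gt0.
pose F i := A (m.+1 + i)%N.
have F0 : P (lim_sup_set F) = 0%E.
  apply: lim_sup_set_cvg0.
    by move=> k; apply: (PA _ _).1; rewrite leq_addr.
  apply: le_lt_trans (nneseries_inv_sqr_lty m (4 * (C * 2 ^+ p)) _ _) => //.
    by apply: lee_nneseries => // k _; apply: (PA _ _).2; rewrite leq_addr.
  by rewrite mulr_ge0// mulr_ge0// exprn_ge0.
exists (lim_sup_set F); split => //.
  apply: bigcap_measurable => // k _; apply: bigcup_measurable => j _.
  by apply: (PA _ _).1; rewrite leq_addr.
move=> w /= H; apply: contrapT => nF; apply: H.
rewrite /lim_sup_set in nF.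
have [k Hk] : exists k, forall j, (k <= j)%N -> ~ F j w.
  apply: contrapT => /forallNP Hk; apply: nF => k _.
  apply: contrapT => nU; apply: (Hk k) => j kj Fj.
  by apply: nU; exists j.
exists (m.+1 + k)%N => // n /= mkn i dev.
have mn : (m.+1 <= n)%N by apply: leq_trans mkn; rewrite leq_addr.
apply: (Hk (n - m.+1)%N); first by rewrite leq_subRL.
by rewrite /F subnKC//; exists i.
Qed.

Lemma sample_covered_sqr g kappa L C p : 0 <= kappa ->
  (forall k z, `|g k z| <= kappa) -> sample_covered g L C p ->
  sample_covered (fun k z => g k z ^+ 2) (2 * kappa * L) C p.
Proof.
move=> k0 gk cov n n1 z; have [N [c [NC Hc]]] := cov n n1 z.
exists N, c; split => // k; have [j Hj] := Hc k; exists j => i.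
rewrite subr_sqr normrM (_ : 2 * kappa * L / n%:R = L / n%:R * (2 * kappa)).
  2: by ring.
rewrite ler_pM//.
by apply: le_trans (ler_normD _ _) _; rewrite mulr2n mulrDl mul1r lerD.
Qed.

(** Since g^4 <= kappa^2 g^2, the preceding lemma applied to the squares bounds
the empirical second moments by 3 n mu(g^2) + O(log n), and this is inserted into
the bound for g itself. *)
Lemma ae_deviation_le (g : nat -> T -> R) (kappa L C : R) (p : nat) (eps : R) :
  0 <= kappa -> 0 <= L -> 0 <= C -> 0 < eps ->
  (forall k, measurable_fun [set: T] (g k)) ->
  (forall k z, `|g k z| <= kappa) ->
  sample_covered g L C p ->
  exists c, {ae P, forall w, \forall n \near \oo, forall k,
    `|\sum_(i < n) g k (X i w) - n%:R * \int[mu]_x g k x| <=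
    c * ln n%:R + eps * (n%:R * \int[mu]_x (g k x ^+ 2))}.
Proof.
move=> k0 L0 C0 eps0 mg gk cov.
(* The first bound serves the conclusion; the second one makes e kappa^2 at most
   1/2, so that the empirical second moment can be solved for. *)
pose e := Num.min (eps / 4) (1 / (2 * (1 + kappa) ^+ 2)).
have d0 : 0 < 2 * (1 + kappa) ^+ 2 by rewrite mulr_gt0// exprn_gt0// ltr_pwDl.
have e0 : 0 < e by rewrite lt_min !divr_gt0.
have e4 : 4 * e <= eps.
  by have : e <= eps / 4; [rewrite ge_min lexx|lra].
have ek : e * (2 * (1 + kappa) ^+ 2) <= 1.
  by rewrite -ler_pdivlMr// ge_min lexx orbT.
have kk0 : 0 <= kappa ^+ 2 by exact: sqr_ge0.
have ek0 : 0 <= e * kappa by rewrite mulr_ge0// ltW.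
have ekk0 : 0 <= e * kappa ^+ 2 by rewrite mulr_ge0// ltW.
have {}ek : e + 2 * (e * kappa) + e * kappa ^+ 2 <= 1 / 2.
  have E : e * (2 * (1 + kappa) ^+ 2) = 2 * (e + 2 * (e * kappa) + e * kappa ^+ 2).
    by ring.
  by rewrite E in ek; lra.
have gk2 k z : `|g k z ^+ 2| <= kappa ^+ 2.
  by rewrite normrX lerXn2r ?nnegrE.
have bg k : bounded_measurable (g k) by split; [|exists kappa].
have mgg k : measurable_fun [set: T] (fun z => g k z ^+ 2) by exact: measurable_funX.
have bgg k : bounded_measurable (fun z => g k z ^+ 2) by exact: bounded_measurableX.
pose c := 512 * p.+2%:R / e.
have H1 := ae_not_deviates g kappa e L C p e0 _ L0 C0 mg gk cov.
have H2 := ae_not_deviates (fun k z => g k z ^+ 2) (kappa ^+ 2) e (2 * kappa * L) C p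
  e0 _ _ C0 mgg gk2 (sample_covered_sqr g kappa L C p k0 gk cov).
have {}H1 := H1 ltac:(lra); have {}H2 := H2 ltac:(lra) ltac:(by rewrite !mulr_ge0).
exists (3 * c); apply: filterS2 H1 H2 => w H1 H2.
apply: filterS2 H1 H2 => n H1 H2 k.
move: (H1 k) (H2 k); rewrite /deviates -/c => /negP {}H1 /negP {}H2.
move: H1 H2; rewrite -!leNgt.
set S := \sum_(i < n) g k (X i w); set V := \sum_(i < n) g k (X i w) ^+ 2.
set W := \sum_(i < n) (g k (X i w) ^+ 2) ^+ 2.
set m1 := \int[mu]_x g k x; set m2 := \int[mu]_x (g k x ^+ 2).
set m4 := \int[mu]_x ((g k x ^+ 2) ^+ 2) => H1 H2.
have sq4 z : (g k z ^+ 2) ^+ 2 <= kappa ^+ 2 * g k z ^+ 2.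
  rewrite expr2 ler_wpM2r ?sqr_ge0//; apply: le_trans (gk2 k z).
  exact: ler_norm.
have WV : W <= kappa ^+ 2 * V.
  by rewrite mulr_sumr; apply: ler_sum => i _; exact: sq4.
have m42 : m4 <= kappa ^+ 2 * m2.
  rewrite -RintegralZl//; last exact: bounded_measurable_integrable.
  apply: le_Rintegral => //.
  - by apply: bounded_measurable_integrable; exact: (bounded_measurableX _ 2%N (bgg k)).
  - apply: bounded_measurable_integrable; apply: bounded_measurableM => //.
    exact: bounded_measurable_cst.
have m20 : 0 <= m2 by apply: Rintegral_ge0 => x _; exact: sqr_ge0.
have V0 : 0 <= V by apply: sumr_ge0 => i _; exact: sqr_ge0.
have n0 : 0 <= n%:R :> R by [].
have q0 : 0 <= n%:R * m2 by exact: mulr_ge0.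
have {}m42 : e * (n%:R * m4) <= e * kappa ^+ 2 * (n%:R * m2).
  rewrite (_ : e * kappa ^+ 2 * _ = e * (n%:R * (kappa ^+ 2 * m2))); last by ring.
  by rewrite ler_wpM2l ?(ltW e0)// ler_wpM2l.
have {}WV : e * W <= e * kappa ^+ 2 * V.
  by rewrite -mulrA ler_wpM2l ?(ltW e0).
have VB : V <= 3 * (n%:R * m2) + 2 * (c * ln n%:R).
  have := le_trans (ler_norm _) H2.
  have : e * kappa ^+ 2 * (n%:R * m2) <= 1 / 2 * (n%:R * m2) by rewrite ler_wpM2r//; lra.
  have : e * kappa ^+ 2 * V <= 1 / 2 * V by rewrite ler_wpM2r//; lra.
  by lra.
have c0 : 0 <= c.
  by apply: divr_ge0; [exact: mulr_ge0 (ler0n _ _) (ler0n _ _)|exact: ltW].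
have ln0 : 0 <= ln n%:R :> R.
  by case: (n) => [|n']; [rewrite ln0|rewrite ln_ge0// ler1n].
have cl0 : 0 <= c * ln n%:R by exact: mulr_ge0 c0 ln0.
have eV := ler_wpM2l (ltW e0) VB.
have ec : e * (c * ln n%:R) <= 1 / 2 * (c * ln n%:R) by rewrite ler_wpM2r//; lra.
have e4q := ler_wpM2r q0 e4.
apply: le_trans H1 _; lra.
Qed.

End strong_law.

(** * Covering at sample points *)

Section empirical.
Context {d} {T : measurableType d} {R : realType}.

(** Q is the empirical measure of the points z; the inequality says that each
point has mass at least 1 / n. *)
Lemma exists_empirical n (z : 'I_n -> T) : (0 < n)%N ->
  exists Q : probability T R, forall (phi : T -> \bar R) i,
    measurable_fun [set: T] phi -> (forall x, (0 <= phi x)%E) ->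
    ((n%:R^-1)%:E * phi (z i) <= \int[Q]_x phi x)%E.
Proof.
move=> n0; pose i0 := Ordinal n0.
pose m k : {measure set T -> \bar R} := \d_(z (insubd i0 k)).
have c0 : 0 <= n%:R^-1 :> R by rewrite invr_ge0.
have nn0 : n%:R != 0 :> R by rewrite pnatr_eq0 -lt0n.
pose q : {measure set T -> \bar R} := mscale (NngNum c0) (msum m n).
have q1 : q [set: T] = 1%E.
  rewrite /q/= /mscale/= /msum (eq_bigr (fun=> 1%E)) => [|i _]; last first.
    by rewrite /m/= diracE mem_set.
  by rewrite sumEFin sumr_const card_ord -EFinM mulVf.
pose Q : probability T R := HB.pack (q : set T -> \bar R)
  (Measure.on q) (Measure_isProbability.Build _ _ _ q q1).
exists Q => phi i mphi phi0.
have -> : (\int[Q]_x phi x = \int[q]_x phi x)%E by [].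
rewrite ge0_integral_mscale// ge0_integral_measure_sum//=.
rewrite lee_wpmul2l ?lee_fin// (bigD1 i)//=.
rewrite integral_dirac// diracE mem_set// mul1e.
rewrite (_ : insubd i0 i = i); last by apply/val_inj; rewrite val_insubd ltn_ord.
by rewrite leeDl// sume_ge0// => j _; exact: integral_ge0.
Qed.

Lemma L2_dist_sqr (Q : probability T R) (f c : T -> R) :
  measurable_fun [set: T] f -> measurable_fun [set: T] c ->
  (\int[Q]_x ((f x - c x) ^+ 2)%:E = L2_dist Q f c `^ 2)%E.
Proof.
move=> mf mc; rewrite /L2_dist poweR_Lnorm//.
by apply: eq_integral => x _ /=; rewrite powR_mulrn// real_normK// num_real.
Qed.

(** The covering hypothesis is applied to the empirical measure with radius
kappa n^-2: as each point has mass at least 1 / n, functions at such a distance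
differ by at most kappa / n at every point. The centres of the balls are
arbitrary, so each one is replaced by a member of the family in its ball, which
doubles the error. *)
Lemma sample_covered_uniform (F : set (T -> R)) (g : nat -> T -> R)
    (kappa C nu : R) (p : nat) :
  0 < kappa -> 0 < C -> 2 * nu <= p%:R ->
  (forall k, F (g k)) -> (forall k, measurable_fun [set: T] (g k)) ->
  (forall eps : R, 0 < eps < 1 ->
    (uniform_covering_number F (kappa * eps) <= (C * eps `^ (- nu))%:E)%E) ->
  sample_covered g (2 * kappa) (C + 1) p.
Proof.
move=> k0 C0 nup Fg mg Hcov n n1 z.
have n0 : (0 < n)%N by exact: ltnW.
have [Q HQ] := exists_empirical n z n0.
have nr1 : 1 < n%:R :> R by rewrite ltr1n.
have nr0 : 0 < n%:R :> R by rewrite ltr0n.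
(* eta < 1, and sqrt n * eta <= 1 / n. *)
pose eta : R := n%:R ^- 2.
have eta01 : 0 < eta < 1.
  by rewrite /eta invr_gt0 exprn_gt0//= invf_lt1 ?exprn_gt0// exprn_egt1.
have : (covering_number Q F (kappa * eta) < (C * n%:R ^+ p + 1)%:E)%E.
  apply: (@le_lt_trans _ _ (C * eta `^ (- nu))%:E).
    by apply: le_trans (Hcov eta eta01); apply: ereal_sup_ubound; exists Q.
  rewrite lte_fin; apply: (@le_lt_trans _ _ (C * n%:R ^+ p)); last by rewrite ltrDl.
  rewrite ler_wpM2l ?(ltW C0)// /eta -(powR_mulrn 2 (ltW nr0)) -powRN -powRrM.
  by rewrite mulrNN -(powR_mulrn p (ltW nr0)) ler_powR// ltW.
move=> /ereal_inf_lt[_ [N [c [cL Fc]] <-]]; rewrite lte_fin => NC.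
have mc j : measurable_fun [set: T] (c j).
  by have /sub_Lfun_mfun := cL j; rewrite inE.
pose near j k := (L2_dist Q (g k) (c j) < (kappa * eta)%:E)%E.
have rep j : exists r, forall k, near j k -> near j r.
  have [[k kj]|/forallNP nk] := pselect (exists k, near j k); first by exists k.
  by exists 0%N => k /nk.
have [r Hr] := choice rep.
exists N, r; split.
  apply: le_trans (ltW NC) _; rewrite mulrDl mul1r lerD2l.
  by rewrite exprn_ege1// ltW.
have close j k i : near j k -> `|g k (z i) - c j (z i)| <= kappa / n%:R.
  move=> kj.
  pose phi x := ((g k x - c j x) ^+ 2)%:E.
  have mphi : measurable_fun [set: T] phi.
    by apply/measurable_EFinP; apply: measurable_funX; exact: measurable_funB.
  have phi0 x : (0 <= phi x)%E by rewrite lee_fin sqr_ge0.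
  have := HQ phi i mphi phi0; rewrite L2_dist_sqr// => H.
  have {}H : ((n%:R^-1)%:E * phi (z i) <= ((kappa * eta) ^+ 2)%:E)%E.
    have ke0 : 0 <= kappa * eta by rewrite mulr_ge0// ltW//; case/andP: eta01.
    apply: le_trans H _; rewrite -powR_mulrn// -poweR_EFin.
    apply: gt0_ler_poweR => //; last exact: ltW.
      by rewrite in_itv/= leey andbT /L2_dist Lnorm_ge0.
    by rewrite in_itv/= leey andbT lee_fin.
  rewrite -EFinM lee_fin in H.
  rewrite -ler_sqr ?nnegrE ?divr_ge0 ?(ltW k0) ?(ltW nr0)// real_normK ?num_real//.
  rewrite mulrC ler_pdivrMr// in H; apply: le_trans H _.
  rewrite /eta !exprMn -mulrA ler_wpM2l ?sqr_ge0//.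
  have -> : (n%:R ^- 2) ^+ 2 * n%:R = n%:R^-1 ^+ 2 * n%:R^-1 :> R.
    by field; rewrite gt_eqF.
  by rewrite ler_piMr ?sqr_ge0// invf_le1// ltW.
move=> k; have [j _ kj] := Fc (g k) (Fg k); exists j => i.
have := close j k i kj; have := close j (r j) i (Hr j k kj).
rewrite !ler_norml => /andP[? ?] /andP[? ?]; rewrite mulrAC -mulrA.
by apply/andP; split; lra.
Qed.

End empirical.

(** * Change of variables in R^d *)

Section lebesgue_rV_affine.
Context {R : realType} {d : nat}.

Definition open_box (a b : 'I_d -> R) : set 'rV[R]_d :=
  [set v | forall i, v ord0 i \in `]a i, b i[].

Definition open_boxes : set (set 'rV[R]_d) :=
  [set open_box ab.1 ab.2 | ab in [set: ('I_d -> R) * ('I_d -> R)]].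

Lemma measurable_open_box a b : measurable (open_box a b).
Proof.
rewrite (_ : open_box a b = \bigcap_(i in [set: 'I_d])
    ((fun v : 'rV[R]_d => v ord0 i) @^-1` `]a i, b i[)).
  apply: fin_bigcap_measurable => [|i _]; first exact: finite_finset.
  by rewrite -[X in measurable X]setTI; exact: measurable_mx_coord.
by apply/seteqP; split => v /= H i; [move=> _; exact: H|exact: H].
Qed.

Lemma open_boxes_cover :
  \bigcup_k open_box (fun=> - k%:R) (fun=> k%:R) = [set: 'rV[R]_d].
Proof.
apply/seteqP; split => // v _.
pose s := \sum_(i < d) `|v ord0 i|.
have s0 : 0 <= s by apply: sumr_ge0 => ? _; exact: normr_ge0.
exists (Num.bound s) => // i; rewrite in_itv/= -ltr_norml.
apply: le_lt_trans (archi_boundP s0); rewrite /s (bigD1 i)//= lerDl.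
by apply: sumr_ge0 => ? _; exact: normr_ge0.
Qed.

(** A map into R^d is measurable as soon as its coordinates are. For the identity
from R^d with the sigma-algebra generated by the boxes, each coordinate is
measurable because a slab is a countable union of boxes. *)
Lemma measurable_open_boxes :
  @measurable _ 'rV[R]_d = <<s open_boxes >>.
Proof.
apply/seteqP; split; last first.
  apply: smallest_sub; first exact: sigma_algebra_measurable.
  by move=> _ [[a b] _ <-]; exact: measurable_open_box.
move=> A mA.
have mid : measurable_fun [set: g_sigma_algebraType open_boxes]
    (id : g_sigma_algebraType open_boxes -> 'rV[R]_d).
  apply: measurable_fun_mxP => i j; rewrite (ord1 i).
  apply: (measurability _ (measurable_realfun.RGenOpens.measurableE R)).
  move=> _ [_ [a [b ->]] <-]; rewrite setTI.
  rewrite (_ : _ @^-1` _ = \bigcup_k open_box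
    (fun l => if l == j then a else - k%:R) (fun l => if l == j then b else k%:R)).
    apply: (@bigcup_measurable _ (g_sigma_algebraType open_boxes)) => k _.
    apply: sub_sigma_algebra.
    by exists (fun l => if l == j then a else - k%:R,
               fun l => if l == j then b else k%:R).
  apply/seteqP; split => v /=.
    move=> vab; have [k _ Hk] : (\bigcup_k open_box (fun=> - k%:R) (fun=> k%:R)) v.
      by rewrite open_boxes_cover.
    by exists k => // l; case: eqP => [->//|_]; exact: Hk.
  by move=> [k _ /(_ j)]; rewrite eqxx.
by have := mid measurableT A mA; rewrite setTI.
Qed.

Lemma open_boxes_setI : setI_closed open_boxes.
Proof.
move=> _ _ [[a b] _ <-] [[a' b'] _ <-].
exists (fun i => Num.max (a i) (a' i), fun i => Num.min (b i) (b' i)) => //.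
apply/seteqP; split => v /=.
  move=> H; split=> i; have := H i; rewrite !in_itv/= gt_max lt_min;
    by move=> /andP[/andP[? ?] /andP[? ?]]; apply/andP.
move=> [H1 H2] i; have := H1 i; have := H2 i; rewrite !in_itv/= gt_max lt_min.
by move=> /andP[-> ->] /andP[-> ->].
Qed.

Lemma lebesgue_rV_unique (m1 m2 : {measure set 'rV[R]_d -> \bar R}) :
  (forall a b, m1 (open_box a b) = m2 (open_box a b)) ->
  (forall a b, (m1 (open_box a b) < +oo)%E) ->
  forall A, measurable A -> m1 A = m2 A.
Proof.
move=> m12 m1oo; apply: (measure_unique open_boxes
  (fun k => open_box (fun=> - k%:R) (fun=> k%:R))).
- exact: measurable_open_boxes.
- exact: open_boxes_setI.
- by move=> k; exists (fun=> - k%:R, fun=> k%:R).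
- exact: open_boxes_cover.
- by move=> _ [[a b] _ <-].
- by move=> k; exact: m1oo.
Qed.

Lemma lebesgue_rV_open_box (a b : 'I_d -> R) :
  lebesgue_rV d (open_box a b) =
  (\prod_(i < d) (Num.max 0 (b i - a i))%:E)%E.
Proof.
rewrite /open_box (@lebesgue_rV_box R d (fun i => [set` `]a i, b i[]))//.
apply: eq_bigr => i _; rewrite lebesgue_measure_itv/= lte_fin.
case: ltP => ab; congr _%:E.
  by rewrite max_r// subr_ge0 ltW.
by rewrite max_l// subr_le0.
Qed.

Hypothesis d_gt0 : (0 < d)%N.

Lemma measurable_rescale (h : R) (x : 'rV[R]_d) :
  measurable_fun [set: 'rV[R]_d] (fun z => rescale h (x - z)).
Proof.
apply: measurable_fun_mxP => i j; under eq_fun do rewrite !mxE.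
apply: measurable_funM => //; apply: measurable_funB => //.
exact: measurable_mx_coord.
Qed.

Lemma powR_invn_exp (h : R) : 0 < h -> (h `^ d%:R^-1) ^+ d = h.
Proof.
move=> h0; rewrite -powR_mulrn ?powR_ge0// -powRrM mulVf ?powRr1 ?ltW//.
by rewrite pnatr_eq0 -lt0n.
Qed.

(** The preimage of a box under z |-> h^(-1/d) (x - z) is a box whose sides are
h^(1/d) times as long; boxes determine the measure. *)
Lemma lebesgue_rV_rescale (h : R) (x : 'rV[R]_d) (A : set 'rV[R]_d) :
  0 < h -> measurable A ->
  lebesgue_rV d ((fun z => rescale h (x - z)) @^-1` A) =
  (h%:E * lebesgue_rV d A)%E.
Proof.
move=> h0 mA; set r := h `^ d%:R^-1.
have r0 : 0 < r by exact: powR_gt0.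
pose phi : {mfun 'rV[R]_d >-> 'rV[R]_d} := HB.pack (fun z => rescale h (x - z))
  (isMeasurableFun.Build _ _ _ _ _ (measurable_rescale h x)).
have h0' : 0 <= h by exact: ltW.
rewrite -[LHS]/(pushforward (lebesgue_rV d) phi A).
rewrite -[RHS]/(mscale (NngNum h0') (lebesgue_rV d) A).
have E a b : pushforward (lebesgue_rV d) phi (open_box a b) =
    (h%:E * lebesgue_rV d (open_box a b))%E.
  rewrite /pushforward (_ : _ @^-1` _ = open_box
      (fun i => x ord0 i - r * b i) (fun i => x ord0 i - r * a i)).
    rewrite !lebesgue_rV_open_box !prodEFin -EFinM; congr _%:E.
    rewrite -[h in RHS](powR_invn_exp h h0) -/r -[d in _ ^+ d]card_ord.
    rewrite -prodr_const -big_split/=; apply: eq_bigr => i _.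
    rewrite maxr_pMr ?ltW// mulr0; congr Num.max; ring.
  apply/seteqP; split => v /= H i; have := H i; rewrite !in_itv/= !mxE -/r.
    rewrite ltr_pdivlMl// ltr_pdivrMl// => /andP[? ?].
    by apply/andP; split; lra.
  move=> /andP[? ?].
  by rewrite ltr_pdivlMl// ltr_pdivrMl//; apply/andP; split; lra.
apply: lebesgue_rV_unique => // a b.
apply: (@le_lt_trans _ _ (h%:E * lebesgue_rV d (open_box a b))%E).
  by rewrite -E.
by rewrite lebesgue_rV_open_box prodEFin -EFinM ltry.
Qed.

End lebesgue_rV_affine.

(** * Integrals under a density and under rescaling *)

Section density.
Context {d} {T : measurableType d} {R : realType}.
Variables (la : {sigma_finite_measure set T -> \bar R}) (nu : probability T R).
Variable f : T -> R.
Hypotheses (mf : measurable_fun [set: T] f) (f0 : forall x, 0 <= f x).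
Hypothesis nuE : forall B, measurable B -> nu B = (\int[la]_(x in B) (f x)%:E)%E.

Lemma density_integrable : la.-integrable [set: T] (EFin \o f).
Proof.
apply/integrableP; split; first exact/measurable_EFinP.
rewrite (eq_integral (EFin \o f)) => [|x _]; last by rewrite /= ger0_norm.
rewrite -nuE// (le_lt_trans (probability_le1 _ _)) ?ltry//.
Qed.

(** The density f is a version of the Radon-Nikodym derivative of nu. *)
Lemma integral_density (phi : T -> R) : bounded_measurable phi ->
  (\int[nu]_x (phi x)%:E = \int[la]_x (phi x * f x)%:E)%E.
Proof.
move=> bphi.
have nula : nu `<< la.
  apply/null_content_dominatesP => A mA A0; rewrite nuE//.
  by apply: null_set_integral => //; exact/measurable_funTS/measurable_EFinP.
have mRN : measurable_fun [set: T] (Radon_Nikodym (charge_of_finite_measure nu) la).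
  by apply: (measurable_int la); exact: Radon_Nikodym_integrable.
rewrite -(Radon_Nikodym_change_of_variables nula measurableT); last first.
  exact: bounded_measurable_integrable.
apply: ae_eq_integral => //.
- apply: emeasurable_funM; last exact: mRN.
  by apply/measurable_EFinP; case: bphi.
- by apply/measurable_EFinP; apply: measurable_funM => //; case: bphi.
have : ae_eq la setT (EFin \o f) (Radon_Nikodym (charge_of_finite_measure nu) la).
  apply: integral_ae_eq => //.
  - exact: density_integrable.
  - by move=> E _ mE; rewrite -Radon_Nikodym_integral// -nuE.
apply: filterS => x /(_ I) /= fx _; rewrite EFinM fx//.
Qed.

Lemma integrable_density (phi : T -> R) : bounded_measurable phi ->
  la.-integrable [set: T] (fun x => (phi x * f x)%:E).
Proof.
move=> [mphi [k phik]].
apply: (le_integrable measurableT _ _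
  (integrableZl measurableT k density_integrable)).
  by apply/measurable_EFinP; exact: measurable_funM.
move=> x _; rewrite lee_fin !normrM ler_wpM2r//.
by apply: le_trans (phik x) _; exact: ler_norm.
Qed.

End density.

Section rescaled_integrals.
Context {R : realType} {d : nat}.
Hypothesis d_gt0 : (0 < d)%N.
Local Notation la := (lebesgue_rV d : {measure set 'rV[R]_d -> \bar R}).

Lemma ge0_integral_rescale (h : R) (x : 'rV[R]_d) (psi : 'rV[R]_d -> \bar R) :
  0 < h -> measurable_fun [set: 'rV[R]_d] psi -> (forall s, (0 <= psi s)%E) ->
  (\int[la]_z psi (rescale h (x - z)) = h%:E * \int[la]_s psi s)%E.
Proof.
move=> h0 mpsi psi0.
pose phi : {mfun 'rV[R]_d >-> 'rV[R]_d} := HB.pack (fun z => rescale h (x - z))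
  (isMeasurableFun.Build _ _ _ _ _ (measurable_rescale h x)).
have h0' : 0 <= h by exact: ltW.
have := ge0_integral_pushforward (measurable_rescale h x) la measurableT mpsi
  (fun s _ => psi0 s).
rewrite preimage_setT => <-.
rewrite -(ge0_integral_mscale la measurableT (NngNum h0'))//.
apply: (eq_measure_integral (mscale (NngNum h0') la)) => [|mphi A mA _].
  exact: measurable_rescale.
exact: (lebesgue_rV_rescale d_gt0 h x A h0 mA).
Qed.

Lemma integral_rescale (h : R) (x : 'rV[R]_d) (psi : 'rV[R]_d -> R) :
  0 < h -> la.-integrable [set: 'rV[R]_d] (EFin \o psi) ->
  la.-integrable [set: 'rV[R]_d] (fun z => (psi (rescale h (x - z)))%:E) /\
  \int[la]_z psi (rescale h (x - z)) = h * \int[la]_s psi s.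
Proof.
move=> h0 ipsi; have [mpsi psioo] := integrableP _ _ _ ipsi.
have mpsi' : measurable_fun [set: 'rV[R]_d] psi by exact/measurable_EFinP.
have ipsi' : la.-integrable [set: 'rV[R]_d] (fun z => (psi (rescale h (x - z)))%:E).
  apply/integrableP; split.
    by apply/measurable_EFinP; apply: (measurableT_comp mpsi'); exact: measurable_rescale.
  rewrite (ge0_integral_rescale h x (fun s => `|(psi s)%:E|%E))//.
  - rewrite lte_mul_pinfty ?lee_fin ?ltW//.
  - exact: measurableT_comp.
split => //.
have pos := integrable_pos_fin_num measurableT ipsi.
have neg := integrable_neg_fin_num measurableT ipsi.
apply: EFin_inj; rewrite EFinM /Rintegral !fineK ?integrable_fin_num//.
rewrite integralE [in RHS]integralE muleBr ?fin_num_adde_defl//.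
congr (_ - _)%E.
- rewrite -(ge0_integral_rescale h x)//; last exact: measurable_funepos.
  by apply: eq_integral => z _; rewrite !(funeposE, funenegE).
- rewrite -(ge0_integral_rescale h x)//; last exact: measurable_funeneg.
  by apply: eq_integral => z _; rewrite !(funeposE, funenegE).
- by rewrite fin_numN.
Qed.

End rescaled_integrals.

(** * Bias and second moment of the rescaled kernel *)

Section smoothing.
Context {R : realType} {d : nat}.
Hypothesis d_gt0 : (0 < d)%N.
Local Notation la := (lebesgue_rV d : {measure set 'rV[R]_d -> \bar R}).

Lemma unif_continuous_coord (f : 'rV[R]_d -> R) : unif_continuous f ->
  forall e, 0 < e -> exists2 del, 0 < del & forall x y : 'rV[R]_d,
    (forall i, `|x ord0 i - y ord0 i| < del) -> `|f x - f y| < e.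
Proof.
move=> /unif_continuousP uf e e0; have [del del0 H] := uf e e0.
exists del => // x y xy; apply: (H (x, y)); split => //= i j.
by rewrite (ord1 i); exact: xy.
Qed.

(** Around each x there is a box of fixed volume on which f >= f x - 1; as f has
integral at most 1, this bounds f x. *)
Lemma unif_continuous_density_bounded (f : 'rV[R]_d -> R) :
  measurable_fun [set: 'rV[R]_d] f -> (forall x, 0 <= f x) ->
  (\int[la]_x (f x)%:E <= 1)%E -> unif_continuous f ->
  exists2 M, 0 < M & forall x, f x <= M.
Proof.
move=> mf f0 f1 uf; have [del del0 H] := unif_continuous_coord f uf 1 ltr01.
have D0 : 0 < (2 * del) ^+ d by rewrite exprn_gt0// mulr_gt0.
exists (1 + ((2 * del) ^+ d)^-1); first by rewrite addr_gt0// invr_gt0.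
move=> x; rewrite -lerBlDl; have [fx1|fx1] := leP (f x - 1) 0.
  by apply: le_trans fx1 _; rewrite invr_ge0 ltW.
pose B := @open_box R d (fun i => x ord0 i - del) (fun i => x ord0 i + del).
have mB : measurable B by exact: measurable_open_box.
have vB : la B = ((2 * del) ^+ d)%:E.
  apply: etrans (lebesgue_rV_open_box _ _) _.
  rewrite prodEFin -[d in RHS]card_ord -prodr_const.
  congr _%:E; apply: eq_bigr => i _; rewrite max_r; first by ring.
  by rewrite (_ : _ - _ = 2 * del); [rewrite mulr_ge0// ltW|ring].
have : ((f x - 1)%:E * la B <= 1)%E.
  rewrite -(integral_cst la mB); apply: le_trans f1.
  apply: (@le_trans _ _ (\int[la]_(y in B) (f y)%:E)%E).
    apply: ge0_le_integral => //.
    - by move=> y _; rewrite lee_fin ltW.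
    - by apply/measurable_EFinP; exact: measurable_funTS.
    move=> y By; rewrite lee_fin.
    have : `|f x - f y| < 1.
      apply: H => i; have := By i; rewrite in_itv/= => /andP[? ?].
      by rewrite ltr_norml; apply/andP; split; lra.
    by rewrite ltr_norml => /andP[? ?]; lra.
  apply: ge0_subset_integral => //; first exact/measurable_EFinP.
  by move=> y _; rewrite lee_fin.
by rewrite vB -EFinM lee_fin -ler_pdivlMr// div1r.
Qed.

Lemma integrable_tail (K : 'rV[R]_d -> R) (e : R) : 0 < e ->
  la.-integrable [set: 'rV[R]_d] (EFin \o K) ->
  exists n : nat, \int[la]_s (`|K s| *
    \1_(~` open_box (fun=> - n%:R) (fun=> n%:R)) s) < e.
Proof.
move=> e0 iK; have [mK _] := integrableP _ _ _ iK.
have mK' : measurable_fun [set: 'rV[R]_d] K by exact/measurable_EFinP.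
pose F n s := `|K s| * \1_(~` open_box (fun=> - n%:R) (fun=> n%:R)) s.
have mF n : measurable_fun [set: 'rV[R]_d] (F n).
  apply: measurable_funM; first exact: measurableT_comp.
  by apply: measurable_indic; apply: measurableC; exact: measurable_open_box.
have Fcvg s : (F n s)%:E @[n --> \oo] --> 0%E.
  have [N _ HN] : (\bigcup_k open_box (fun=> - k%:R) (fun=> k%:R)) s.
    by rewrite open_boxes_cover.
  apply: cvg_near_cst; exists N => // n /= Nn.
  rewrite /F indicE memNset ?mulr0// => nb; apply: nb => i; have := HN i.
  rewrite !in_itv/= -!ltr_norml => /lt_le_trans; apply.
  by rewrite ler_nat.
have absK : la.-integrable [set: 'rV[R]_d] (fun s => `|K s|%:E).
  exact: integrable_abse iK.
have FK n s : (`|(F n s)%:E| <= (`|K s|%R)%:E)%E.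
  rewrite /F/= lee_fin normrM normr_id ler_piMr// indicE.
  by case: (_ \in _); rewrite /= ?normr1 ?normr0.
have [iF0 _ lim] := @dominated_convergence _ _ _ la _ measurableT
  (fun n => EFin \o F n) (cst 0%E) (fun s => `|K s|%:E)
  (fun n => (measurable_EFinP _ _).2 (mF n)) (measurable_cst _)
  (aeW _ (fun s _ => Fcvg s)) absK (aeW _ (fun s n _ => FK n s)).
rewrite integral0 in lim.
have iF n : la.-integrable [set: 'rV[R]_d] (EFin \o F n).
  apply: le_integrable absK => //; first exact/measurable_EFinP.
  by move=> s _; rewrite (le_trans (FK n s))//= lee_fin normr_id.
have /fine_cvgP[_ lim'] := lim.
have /cvgr_lt/(_ e e0)[n _ Hn] := lim'.
by exists n; apply: (Hn n) => /=.
Qed.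

Section kernel_means.
Variables (nu : probability 'rV[R]_d R) (f K : 'rV[R]_d -> R) (kappa M : R).
Hypotheses (mf : measurable_fun [set: 'rV[R]_d] f) (f0 : forall x, 0 <= f x).
Hypothesis nuE : forall B, measurable B ->
  nu B = (\int[lebesgue_rV d]_(x in B) (f x)%:E)%E.
Hypothesis fM : forall x, f x <= M.
Hypothesis mK : measurable_fun [set: 'rV[R]_d] K.
Hypothesis Kk : forall x, `|K x| <= kappa.
Hypothesis iK : la.-integrable [set: 'rV[R]_d] (EFin \o K).
Let g h x z := K (rescale h (x - z)).

Let bg h x : bounded_measurable (g h x).
Proof.
split; last by exists kappa => z; exact: Kk.
by apply: (measurableT_comp mK); exact: measurable_rescale.
Qed.

Let M0 : 0 <= M. Proof. by apply: le_trans (fM 0); exact: f0. Qed.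

Let absK : la.-integrable [set: 'rV[R]_d] (fun s => (`|K s|)%:E).
Proof. exact: integrable_abse iK. Qed.

Let measurable_affine x (r : R) :
  measurable_fun [set: 'rV[R]_d] (fun s : 'rV[R]_d => x - r *: s).
Proof.
apply: measurable_fun_mxP => i j; under eq_fun do rewrite !mxE.
apply: measurable_funB => //; apply: measurable_funM => //.
exact: measurable_mx_coord.
Qed.

(** By the change of variables, with f <= M and K^2 <= kappa |K|. *)
Lemma second_moment_kernel h x : 0 < h ->
  \int[nu]_z (g h x z ^+ 2) <= M * kappa * (\int[la]_s `|K s|) * h.
Proof.
move=> h0; have k0 : 0 <= kappa by apply: le_trans (Kk 0).
rewrite -lee_fin EFin_Rintegral; last exact: bounded_measurableX.
rewrite (integral_density (lebesgue_rV d) nu f mf f0 nuE);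
  last exact: bounded_measurableX.
apply: (@le_trans _ _ (\int[la]_z ((M * kappa)%:E * (`|g h x z|)%:E))%E).
  apply: ge0_le_integral => //.
  - by move=> z _; rewrite lee_fin mulr_ge0// sqr_ge0.
  - apply/measurable_EFinP; apply: measurable_funM => //.
    by apply: measurable_funX; case: (bg h x).
  - apply: emeasurable_funM => //; apply/measurable_EFinP.
    by apply: measurableT_comp => //; case: (bg h x).
  move=> z _; rewrite -EFinM lee_fin -[M * _ * _]mulrA mulrC.
  apply: ler_pM => //; first exact: sqr_ge0.
  rewrite -real_normK ?num_real// expr2 ler_wpM2r//; exact: Kk.
rewrite ge0_integralZl_EFin//; last 2 first.
- by apply/measurable_EFinP; apply: measurableT_comp => //; case: (bg h x).
- exact: mulr_ge0.
rewrite (ge0_integral_rescale d_gt0 h x (fun s => (`|K s|)%:E))//; last first.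
  by apply/measurable_EFinP; exact: measurableT_comp.
have -> : (\int[la]_s (`|K s|)%:E)%E = (\int[la]_s `|K s|)%:E.
  by rewrite /Rintegral fineK// integrable_fin_num.
by rewrite -!EFinM lee_fin le_eqVlt; apply/orP; left; apply/eqP; ring.
Qed.

Hypothesis K1 : \int[la]_s K s = 1.

(** Both h^-1 nu(g) and f x are integrals against h^-1 K (rescale h (x - z)) dz,
the first of f and the second of the constant f x, because this kernel has
integral 1. *)
Lemma bias_le_integral h x : 0 < h ->
  (`|h^-1 * \int[nu]_z g h x z - f x|%:E <=
  \int[la]_s (`|K s| * `|f (x - (h `^ d%:R^-1) *: s) - f x|)%:E)%E.
Proof.
move=> h0.
have r0 : 0 < h `^ d%:R^-1 by exact: powR_gt0.
have [ig Eg] := integral_rescale d_gt0 h x K h0 iK.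
rewrite K1 mulr1 -/(g h x) in Eg.
have igf := integrable_density (lebesgue_rV d) nu f mf f0 nuE (g h x) (bg h x).
have Ef : \int[nu]_z g h x z = \int[la]_z (g h x z * f z).
  by rewrite /Rintegral (integral_density (lebesgue_rV d) nu f mf f0 nuE).
have igx : la.-integrable [set: 'rV[R]_d] (fun z => (g h x z * f x)%:E).
  by apply: eq_integrable (integrableZr measurableT (f x) ig).
have -> : h^-1 * \int[nu]_z g h x z - f x =
    h^-1 * \int[la]_z (g h x z * f z - g h x z * f x).
  rewrite Ef RintegralB// (RintegralZr (f x) measurableT ig)// Eg mulrBr mulrA.
  by rewrite mulVf ?gt_eqF// mul1r.
rewrite normrM EFinM gtr0_norm ?invr_gt0//.
rewrite -lee_pdivlMl ?invr_gt0// invrK.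
have igd := integrableB measurableT igf igx.
rewrite EFin_normr_Rintegral//.
apply: le_trans (le_abse_integral _ measurableT (measurable_int _ igd)) _.
pose psi s := (`|K s| * `|f (x - (h `^ d%:R^-1) *: s) - f x|)%:E.
have psi0 s : (0 <= psi s)%E by rewrite lee_fin mulr_ge0.
rewrite -(ge0_integral_rescale d_gt0 h x psi h0 _ psi0); last first.
  apply/measurable_EFinP; apply: measurable_funM; first exact: measurableT_comp.
  apply: measurableT_comp => //; apply: measurable_funB => //.
  exact: (measurableT_comp mf (measurable_affine _ _)).
rewrite le_eqVlt; apply/orP; left; apply/eqP; apply: eq_integral => z _.
rewrite /= -mulrBr normrM; congr (_ * `|f _ - _|)%:E.
by rewrite /rescale scalerA mulfV ?gt_eqF// scale1r opprB addrC subrK.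
Qed.

(** On a large box the increments of f are below e / (2 (I + 1)), where I is the
integral of |K|; outside of it they are at most M, and the box is chosen so that
the integral of |K| there is below e / (2 (M + 1)). *)
Lemma kernel_bias_small e : unif_continuous f -> 0 < e ->
  exists2 del, 0 < del & forall h x, 0 < h < del ->
    `|h^-1 * \int[nu]_z g h x z - f x| <= e.
Proof.
move=> uf e0; pose I := \int[la]_s `|K s|.
have I0 : 0 <= I by apply: Rintegral_ge0.
have e1 : 0 < e / (2 * (I + 1)) by rewrite divr_gt0// mulr_gt0// ltr_wpDl.
have [eta eta0 Heta] := unif_continuous_coord f uf _ e1.
have e2 : 0 < e / (2 * (M + 1)) by rewrite divr_gt0// mulr_gt0// ltr_wpDl.
have [N HN] := integrable_tail K _ e2 iK.
set tail := \int[la]_s _ in HN.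
have eN : 0 < eta / N.+1%:R by rewrite divr_gt0.
exists ((eta / N.+1%:R) ^+ d); first by rewrite exprn_gt0.
move=> h x /andP[h0 hd]; set r := h `^ d%:R^-1.
have r0 : 0 < r by exact: powR_gt0.
have rN : r < eta / N.+1%:R.
  by rewrite -(ltr_pXn2r d_gt0) ?nnegrE ?ltW// powR_invn_exp.
rewrite -lee_fin; apply: le_trans (bias_le_integral h x h0) _.
pose A := ~` @open_box R d (fun=> - N%:R) (fun=> N%:R).
have mA : measurable A by apply: measurableC; exact: measurable_open_box.
have iT : la.-integrable [set: 'rV[R]_d] (fun s => (`|K s| * \1_A s)%:E).
  apply: le_integrable absK => //.
    apply/measurable_EFinP; apply: measurable_funM; first exact: measurableT_comp.
    exact: measurable_indic.
  move=> s _ /=; rewrite lee_fin normrM normr_id ler_piMr// indicE.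
  by case: (_ \in _); rewrite /= ?normr1 ?normr0.
have i1 := integrableZl measurableT (e / (2 * (I + 1))) absK.
have i2 := integrableZl measurableT M iT.
apply: (@le_trans _ _ (\int[la]_s ((e / (2 * (I + 1)))%:E * (`|K s|)%:E +
   M%:E * (`|K s| * \1_A s)%:E))%E).
  apply: ge0_le_integral => //.
  - apply/measurable_EFinP; apply: measurable_funM; first exact: measurableT_comp.
    apply: measurableT_comp => //; apply: measurable_funB => //.
    exact: (measurableT_comp mf (measurable_affine _ _)).
  - exact: measurable_int (integrableD measurableT i1 i2).
  move=> s _; rewrite -!EFinM -EFinD lee_fin indicE.
  have [sA|sA] := boolP (s \in A).
    rewrite /= mulr1 -[leLHS]add0r; apply: lerD; first by rewrite mulr_ge0// ltW.
    rewrite mulrC ler_wpM2r//.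
    have := f0 x; have := fM x; have := f0 (x - r *: s); have := fM (x - r *: s).
    by move=> ? ? ? ?; rewrite ler_norml; apply/andP; split; lra.
  rewrite /= !mulr0 addr0 mulrC ler_wpM2r// ltW//; apply: Heta => i.
  rewrite !mxE addrAC subrr add0r normrN normrM gtr0_norm//.
  have : s ord0 i \in `](- N%:R), N%:R[.
    move: sA; rewrite notin_setE /A /= => /contrapT; exact.
  rewrite in_itv/= -ltr_norml => sN.
  apply: (@le_lt_trans _ _ (r * N.+1%:R)); last by rewrite -ltr_pdivlMr.
  by rewrite ler_wpM2l ?(ltW r0)// (le_trans (ltW sN))// ler_nat.
rewrite integralD// !integralZl//.
have -> : (\int[la]_s (`|K s|)%:E)%E = I%:E.
  by rewrite /I /Rintegral fineK// integrable_fin_num.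
have -> : (\int[la]_s (`|K s| * \1_A s)%:E)%E = tail%:E.
  by rewrite /tail /Rintegral fineK// integrable_fin_num.
rewrite -!EFinM -EFinD lee_fin.
have half a : 0 <= a -> a * (e / (2 * (a + 1))) <= e / 2.
  move=> a0; have a1 : 0 < a + 1 by rewrite ltr_wpDl.
  rewrite mulrA ler_pdivrMr ?mulr_gt0// mulrA divfK// mulrC ler_wpM2l ?(ltW e0)//.
  by rewrite lerDl.
have H1 := half I I0; have H2 := half M M0.
have H3 : M * tail <= M * (e / (2 * (M + 1))) by rewrite ler_wpM2l// ltW.
by lra.
Qed.

End kernel_means.

End smoothing.

(** * Passage from the countable subclass to the class *)

Section limits.
Context {d : measure_display} {T : measurableType d} {R : realType}.
Variable Q : probability T R.

Lemma cvg_Rintegral_bounded (u : nat -> T -> R) (g : T -> R) kappa :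
  (forall m, measurable_fun [set: T] (u m)) -> measurable_fun [set: T] g ->
  (forall m z, `|u m z| <= kappa) -> (forall z, u m z @[m --> \oo] --> g z) ->
  \int[Q]_z u m z @[m --> \oo] --> \int[Q]_z g z.
Proof.
move=> mu mg uk ug.
have ik : Q.-integrable [set: T] (EFin \o (fun=> kappa)).
  exact/bounded_measurable_integrable/bounded_measurable_cst.
have ucvg z : (u m z)%:E @[m --> \oo] --> (g z)%:E.
  by apply: cvg_EFin => //; [exact: nearW|exact: ug].
have [_ _ lim] := @dominated_convergence _ _ _ Q _ measurableT
  (fun m => EFin \o u m) (EFin \o g) (EFin \o (fun=> kappa))
  (fun m => (measurable_EFinP _ _).2 (mu m)) ((measurable_EFinP _ _).2 mg)
  (aeW _ (fun z _ => ucvg z)) ik (aeW _ (fun z m _ => uk m z)).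
have bg : bounded_measurable g.
  split => //; exists kappa => z.
  apply: (ler_cvg_to (cvg_norm (ug z)) (cvg_cst kappa)).
  exact: nearW.
have lim' : (\int[Q]_z (u m z)%:E)%E @[m --> \oo] --> (\int[Q]_z g z)%:E.
  by rewrite EFin_Rintegral.
by move/fine_cvgP : lim' => [].
Qed.

End limits.

Lemma countable_enum {T : Type} (A : set T) : countable A -> A !=set0 ->
  exists g : nat -> T, (forall n, A (g n)) /\ forall x, A x -> exists n, g n = x.
Proof.
move=> /countable_injP[f finj] [x0 Ax0].
have rep n : exists y, A y /\ forall x, A x -> f x = n -> y = x.
  have [[y [Ay fy]]|nex] := pselect (exists y, A y /\ f y = n).
    exists y; split => // x Ax fx; apply: finj; rewrite ?inE//.
    by rewrite fy fx.
  by exists x0; split => // x Ax fx; exfalso; apply: nex; exists x.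
have [g Hg] := choice rep.
exists g; split => [n|x Ax]; first exact: (Hg n).1.
by exists (f x); exact: (Hg _).2.
Qed.

Section deviation_closure.
Context {disp disp' : measure_display} {Omega : measurableType disp}
  {T : measurableType disp'} {R : realType} (P : probability Omega R).
Variable X : nat -> {RV P >-> T}.
Local Notation mu := (distribution P (X 0%N)).

(** The values of the functions at the sample points and, by dominated
convergence, their first two moments pass to the limit. *)
Lemma deviation_le_limit (u : nat -> T -> R) (g : T -> R) (kappa : R) n
    (c e : R) (w : Omega) :
  (forall m, measurable_fun [set: T] (u m)) -> measurable_fun [set: T] g ->
  (forall m z, `|u m z| <= kappa) -> (forall z, u m z @[m --> \oo] --> g z) ->
  (forall m, `|\sum_(i < n) u m (X i w) - n%:R * \int[mu]_x u m x| <=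
     c + e * (n%:R * \int[mu]_x (u m x ^+ 2))) ->
  `|\sum_(i < n) g (X i w) - n%:R * \int[mu]_x g x| <=
     c + e * (n%:R * \int[mu]_x (g x ^+ 2)).
Proof.
move=> mu_ mg uk ug H.
have u2k m z : `|u m z ^+ 2| <= kappa ^+ 2.
  by rewrite normrX lerXn2r ?nnegrE// (le_trans _ (uk m z)).
have ug2 z : u m z ^+ 2 @[m --> \oo] --> g z ^+ 2 by exact: cvgM.
have lim1 := cvg_Rintegral_bounded mu u g kappa mu_ mg uk ug.
have lim2 := cvg_Rintegral_bounded mu (fun m z => u m z ^+ 2) (fun z => g z ^+ 2)
  (kappa ^+ 2) (fun m => measurable_funX 2 (mu_ m)) (measurable_funX 2 mg) u2k
  ug2.
have cvgS : \sum_(i < n) u m (X i w) @[m --> \oo] --> \sum_(i < n) g (X i w).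
  elim: (n) => [|k IHk].
    by under eq_cvg do rewrite big_ord0; rewrite big_ord0; exact: cvg_cst.
  under eq_cvg do rewrite big_ord_recr.
  by rewrite big_ord_recr; apply: cvgD => //; exact: ug.
have cvgn (v : nat -> R) (l : R) : v m @[m --> \oo] --> l ->
    n%:R * v m @[m --> \oo] --> n%:R * l.
  by move=> vl; apply: cvgM => //; exact: cvg_cst.
have cvgl : `|\sum_(i < n) u m (X i w) - n%:R * \int[mu]_x u m x| @[m --> \oo] -->
    `|\sum_(i < n) g (X i w) - n%:R * \int[mu]_x g x|.
  by apply: cvg_norm; apply: cvgB => //; exact: cvgn.
have cvgr : c + e * (n%:R * \int[mu]_x (u m x ^+ 2)) @[m --> \oo] -->
    c + e * (n%:R * \int[mu]_x (g x ^+ 2)).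
  apply: cvgD; first exact: cvg_cst.
  by apply: cvgM; [exact: cvg_cst|exact: cvgn].
by apply: (ler_cvg_to cvgl cvgr); exact: nearW.
Qed.

End deviation_closure.

(** * Uniform in bandwidth consistency *)

Theorem corollary1 (R : realType) (d : nat) (d_gt0 : (0 < d)%N)
    (disp : measure_display) (Omega : measurableType disp)
    (P : probability Omega R) (X : nat -> {RV P >-> 'rV[R]_d})
    (f K : 'rV[R]_d -> R) (kappa : R) (a b : nat -> R) :
  mutually_independent P X ->
  identically_distributed P X ->
  has_lebesgue_density P (X 0%N) f ->
  measurable_fun [set: 'rV[R]_d] K ->
  (* (K.i) *)
  (\int[lebesgue_rV d]_s (K s)%:E = 1)%E ->
  (* (K.ii) *)
  sup_norm K = kappa%:E ->
  (* (K.iii) *)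
  (exists C nu : R, [/\ 0 < C, 0 < nu & forall eps : R, 0 < eps < 1 ->
    (uniform_covering_number (kernel_class K) (kappa * eps)
       <= (C * eps `^ (- nu))%:E)%E]) ->
  (* (K.iv) *)
  pointwise_measurable_class (kernel_class K) ->
  (* (K.v) *)
  (\int[lebesgue_rV d]_x radial_majorant K x < +oo)%E ->
  (forall n, (0 < n)%N -> [/\ 0 < a n, a n < b n & b n < 1]) ->
  b n @[n --> \oo] --> 0 ->
  n%:R * a n / ln (n%:R) @[n --> \oo] --> +oo ->
  unif_continuous f ->
  {ae P, forall w,
    ereal_sup [set sup_norm (fun x => kde K (fun i => X i w) n h x - f x)
                | h in `[a n, b n]] @[n --> \oo] --> 0%E}.
Proof.
move=> indep ident [mf f0 nuE] mK K1 supK [C [nu [C0 nu0 cov]]] pmc _ ab b0 na uf.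
pose mu := distribution P (X 0%N).
pose la : {measure set 'rV[R]_d -> \bar R} := lebesgue_rV d.
have Kk x : `|K x| <= kappa.
  by rewrite -lee_fin -supK; apply: ereal_sup_ubound; exists x.
have iK : la.-integrable [set: 'rV[R]_d] (EFin \o K).
  apply/integrableP; split; first exact/measurable_EFinP.
  by rewrite integral_fin_num_abs// /la K1.
have RK1 : \int[la]_s K s = 1 by rewrite /Rintegral /la K1.
have k0 : 0 < kappa.
  rewrite lt_neqAle (le_trans _ (Kk 0))// andbT; apply/eqP => kE.
  have K0 x : K x = 0 by apply/eqP; rewrite -normr_le0 kE Kk.
  move/eqP: RK1; under eq_Rintegral do rewrite K0.
  by rewrite Rintegral_cst// mul0r eq_sym oner_eq0.
have [M M0 fM] : exists2 M, 0 < M & forall x, f x <= M.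
  apply: unif_continuous_density_bounded => //.
  by rewrite -nuE// probability_le1.
have mg (g : 'rV[R]_d -> R) : kernel_class K g -> measurable_fun [set: 'rV[R]_d] g.
  by move=> [h [x [_ ->]]]; apply: (measurableT_comp mK); exact: measurable_rescale.
have gk (g : 'rV[R]_d -> R) z : kernel_class K g -> `|g z| <= kappa.
  by move=> [h [x [_ ->]]]; exact: Kk.
have [F0 [F0K cF0 F0lim]] := pmc.
have [g [F0g gF0]] : exists g : nat -> 'rV[R]_d -> R,
    (forall n, F0 (g n)) /\ forall u, F0 u -> exists n, g n = u.
  apply: countable_enum => //.
  have [|u [F0u _]] := F0lim (fun z => K (rescale 1 (0 - z))).
    by exists 1, 0; rewrite ltr01.
  by exists (u 0%N).
(* (eta = n^-2) ^ - nu = n^(2 nu), hence the exponent. *)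
have scov : sample_covered g (2 * kappa) (C + 1) (Num.bound (2 * nu)).
  apply: (sample_covered_uniform (kernel_class K)) cov => //.
  - by rewrite ltW// archi_boundP// mulr_ge0// ltW.
  - by move=> k; exact: F0K.
  - by move=> k; apply: mg; exact: F0K.
pose eps (j : nat) : R := j.+1%:R^-1.
have [c Hc] := choice (fun j => ae_deviation_le P X indep ident g kappa (2 * kappa)
  (C + 1) (Num.bound (2 * nu)) (eps j) (ltW k0) ltac:(by rewrite mulr_ge0 ?(ltW k0))
  ltac:(by rewrite addr_ge0 ?(ltW C0)) ltac:(by rewrite invr_gt0)
  (fun k => mg _ (F0K _ (F0g k))) (fun k z => gk _ z (F0K _ (F0g k))) scov).
have := ae_foralln Hc.
apply: filterS => w Hw.
pose A := M * kappa * \int[la]_s `|K s|.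
have A0 : 0 <= A.
  by rewrite mulr_ge0//; [rewrite mulr_ge0// ltW|exact: Rintegral_ge0].
have bound del : 0 < del -> \forall n \near \oo, forall h x,
    a n <= h <= b n -> `|kde K (fun i => X i w) n h x - f x| <= del.
  move=> del0; have del34 : del / 2 + del / 4 <= del by lra.
  (* The fluctuation is split into c_j log n / (n h) and eps_j A; these two terms
     and the bias get del / 4 each. *)
  pose j := Num.bound (4 * (A + 1) / del).
  have epsA : eps j * A <= del / 4.
    have Ad0 : 0 < 4 * (A + 1) / del by rewrite divr_gt0// mulr_gt0// ltr_wpDl.
    have := archi_boundP (ltW Ad0); rewrite -/j ltr_pdivrMr// => jA.
    rewrite /eps mulrC ler_pdivrMr//.
    have -> : j.+1%:R = j%:R + 1 :> R by rewrite natr1.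
    by lra.
  have [del' del'0 Hbias] := kernel_bias_small d_gt0 mu f K kappa M mf f0 nuE fM mK Kk iK
    RK1 (del / 4) uf ltac:(by rewrite divr_gt0).
  have Hb : \forall n \near \oo, b n < del'.
    by have /cvgr_lt := b0; apply.
  have Hna : \forall n \near \oo, 4 * (`|c j| + 1) / del <= n%:R * a n / ln n%:R.
    by have /cvgryPge := na; apply.
  have Hn2 : \forall n \near \oo, (1 < n)%N by exists 2%N.
  near=> n => h x /andP[anh hbn].
  have n1 : (1 < n)%N by near: n.
  have nr0 : 0 < n%:R :> R by rewrite ltr0n ltnW.
  have [an0 _ _] := ab n (ltnW n1).
  have h0 : 0 < h by apply: lt_le_trans an0 anh.
  have ln0 : 0 < ln n%:R :> R by rewrite ln_gt0// ltr1n.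
  have nh0 : 0 < n%:R * h by rewrite mulr_gt0.
  pose G z := K (rescale h (x - z)).
  have KG : kernel_class K G by exists h, x.
  have [u [F0u uG]] := F0lim G KG.
  have dev : `|\sum_(i < n) G (X i w) - n%:R * \int[mu]_z G z| <=
      c j * ln n%:R + eps j * (n%:R * \int[mu]_z (G z ^+ 2)).
    apply: (deviation_le_limit P X u G kappa) => //.
    - by move=> m; apply: mg; exact: F0K.
    - exact: mg.
    - by move=> m z; apply: gk; exact: F0K.
    - move=> m; have [k <-] := gF0 _ (F0u m).
      by move: k; near: n; exact: (Hw j).
  have var := second_moment_kernel d_gt0 mu f K kappa M mf f0 nuE fM mK Kk iK h x h0.
  rewrite -/A in var.
  have bias : `|h^-1 * \int[mu]_z G z - f x| <= del / 4.
    apply: Hbias; rewrite h0/=; apply: le_lt_trans hbn _.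
    by near: n.
  have nal : c j * ln n%:R <= del / 4 * (n%:R * h).
    have : 4 * (`|c j| + 1) / del <= n%:R * a n / ln n%:R by near: n.
    rewrite ler_pdivrMr// mulrAC ler_pdivlMr// => H.
    have H1 : n%:R * a n <= n%:R * h by rewrite ler_wpM2l.
    have H2 : c j * ln n%:R <= (`|c j| + 1) * ln n%:R.
      by rewrite ler_wpM2r ?(ltW ln0)// (le_trans (ler_norm _))// lerDl.
    have H3 := ler_wpM2r (ltW del0) H1.
    by lra.
  have -> : kde K (fun i => X i w) n h x - f x =
      (\sum_(i < n) G (X i w) - n%:R * \int[mu]_z G z) / (n%:R * h) +
      (h^-1 * \int[mu]_z G z - f x).
    by rewrite /kde -/(G _); field; rewrite !gt_eqF.
  apply: le_trans (ler_normD _ _) _.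
  have H1 : `|(\sum_(i < n) G (X i w) - n%:R * \int[mu]_z G z) / (n%:R * h)| <= del / 2.
    rewrite normrM normfV (gtr0_norm nh0) ler_pdivrMr//.
    apply: le_trans dev _.
    have : eps j * (n%:R * \int[mu]_z (G z ^+ 2)) <= del / 4 * (n%:R * h).
      apply: (@le_trans _ _ (eps j * (n%:R * (A * h)))).
        by rewrite ler_wpM2l ?invr_ge0// ler_wpM2l.
      rewrite (_ : eps j * _ = eps j * A * (n%:R * h)); last by ring.
      by rewrite ler_wpM2r// ltW.
    by lra.
  exact: le_trans (lerD H1 bias) del34.
pose s n := ereal_sup [set sup_norm (fun x => kde K (fun i => X i w) n h x - f x)
  | h in `[a n, b n]].
have s_le del : 0 < del -> \forall n \near \oo, (s n <= del%:E)%E.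
  move=> del0; have := bound del del0; apply: filterS => n Hn.
  apply: ge_ereal_sup => _ [h /= hab <-].
  apply: ge_ereal_sup => _ [x _ <-]; rewrite lee_fin; apply: Hn.
  by move: hab; rewrite in_itv.
have s_ge0 : \forall n \near \oo, (0 <= s n)%E.
  exists 1%N => // n /= n1.
  have [an0 anbn _] := ab n n1.
  apply: (@le_trans _ _ (sup_norm (fun x => kde K (fun i => X i w) n (a n) x - f x))).
    by apply: le_trans (ereal_sup_ubound _); last by exists 0; [|reflexivity].
  by apply: ereal_sup_ubound; exists (a n) => //=; rewrite in_itv/= lexx ltW.
apply/fine_cvgP; split.
  near=> n; rewrite fin_numE -ltey -ltNye.
  apply/andP; split.
    by apply: (@lt_le_trans _ _ 0%E) => //; near: n.
  by apply: (@le_lt_trans _ _ 1%:E); [near: n; exact: s_le|exact: ltry].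
apply/cvgr0Pnorm_le => del del0; near=> n => /=.
have sn0 : (0 <= s n)%E by near: n.
have snd : (s n <= del%:E)%E by near: n; exact: s_le.
rewrite -/(s n) ger0_norm ?fine_ge0//.
by rewrite -lee_fin fineK// ge0_fin_numE// (le_lt_trans snd) ?ltry.
Unshelve. all: by end_near.
Qed.
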